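(* $\pi(P \square P) \ge 6$ and $\pi(P \boxtimes P) \ge 9$.
   Context: $P$ denotes the infinite path: $V(P)=\mathbb{Z}$, with $i \sim j$ if and only if $|i-j|=1$. The Cartesian product $G \square H$ has vertex set $V(G)\times V(H)$, with $(u_1,v_1)\sim(u_2,v_2)$ iff either $u_1=u_2$ and $v_1v_2\in E(H)$, or $v_1=v_2$ and $u_1u_2\in E(G)$. The strong product $G\boxtimes H$ has vertex set $V(G)\times V(H)$, with $(u_1,v_1)\sim(u_2,v_2)$ iff either $u_1=u_2$ and $v_1v_2\in E(H)$, or $v_1=v_2$ and $u_1u_2\in E(G)$, or $u_1u_2\in E(G)$ and $v_1v_2\in E(H)$. A vertex coloring $f$ of a graph $G$ is non-repetitive if there is no path $\langle v_1,\dots,v_{2k}\rangle$ in $G$ ($k\ge1$) with $f(v_i)=f(v_{k+i})$ for all $1\le i\le k$. The non-repetitive chromatic number (Thue number) $\pi(G)$ is the minimum number of colors in a non-repetitive coloring of $G$. *)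

(* Defs.v *)
From mathcomp Require Import all_boot all_algebra.
Set Implicit Arguments. Unset Strict Implicit. Unset Printing Implicit Defensive.
Import GRing.Theory Num.Theory.

(* A (simple, possibly infinite) graph is given by its adjacency relation
   on a vertex type (an eqType). *)

Definition P_adj : rel int := fun i j => (`|i - j| == 1)%R.

Definition cart_adj (U V : eqType) (g : rel U) (h : rel V) : rel (U * V) :=
  fun x y => ((x.1 == y.1) && h x.2 y.2) || ((x.2 == y.2) && g x.1 y.1).

Definition strong_adj (U V : eqType) (g : rel U) (h : rel V) : rel (U * V) :=
  fun x y => [|| (x.1 == y.1) && h x.2 y.2,
                 (x.2 == y.2) && g x.1 y.1
               | g x.1 y.1 && h x.2 y.2].

Definition is_gpath (V : eqType) (adj : rel V) (p : seq V) : bool :=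
  uniq p && (if p is x :: s then path adj x s else true).

Definition nonrepetitive (V : eqType) (C : Type) (adj : rel V) (f : V -> C) : Prop :=
  forall (k : nat) (p : seq V), (0 < k)%N -> size p = (2 * k)%N -> is_gpath adj p ->
    map f (take k p) <> map f (drop k p).

Definition thue_ge (V : eqType) (adj : rel V) (m : nat) : Prop :=
  forall (k : nat) (f : V -> 'I_k), nonrepetitive adj f -> (m <= k)%N.

(* Main.v *)
(* Suppose a coloring with too few colors is nonrepetitive.  Case distinctions
   on the colors of finitely many cells, each ending in a short repetitive path,
   exclude a sequence of small patterns one after the other; the patterns already
   excluded may be used, in all positions up to the symmetries of the square, to
   exclude the next.
   For the Cartesian product and 5 colors: a vertex with three neighbors of the
   same color, then one whose opposite neighbors agree in pairs, then one with two
   opposite neighbors of the same color, then a 2 x 2 square with two equal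
   corners.  Now all closed neighborhoods are rainbow, and few cases remain.
   For the strong product and 8 colors: two cells of the same color that differ by
   (2, 0), then by (2, 1), then by (2, 2).  Now the nine cells of a 3 x 3 square
   have distinct colors.
   The case distinctions come from a computer search. *)

Require Import Defs.
From mathcomp Require Import all_boot all_algebra.

Set Implicit Arguments.
Unset Strict Implicit.
Unset Printing Implicit Defensive.
Import GRing.Theory Num.Theory.

(** * Nonrepetitive colorings: pullback and properness *)

Section NonrepetitiveBasics.

Variables (U V : eqType) (C : Type) (g : rel U) (h : rel V).

(** An injective homomorphism carries paths to paths of the same length, so a repetition in the
    pulled-back coloring would be a repetition of [f]. With [phi] a symmetry of the grid, this moves
    an excluded pattern to all positions. *)
Lemma nonrepetitive_comp (phi : U -> V) (f : V -> C) :
  injective phi -> {homo phi : x y / g x y >-> h x y} ->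
  nonrepetitive h f -> nonrepetitive g (f \o phi).
Proof.
move=> phi_inj phi_hom nr_f k p k_gt0 size_p /andP[uniq_p path_p].
rewrite (map_comp f phi (take k p)) (map_comp f phi (drop k p)) map_take map_drop.
apply: nr_f => //; first by rewrite size_map.
rewrite /is_gpath map_inj_uniq // uniq_p /=.
by case: p path_p {uniq_p size_p} => //= x s; apply: homo_path.
Qed.

(** Two adjacent vertices form a path with k = 1. They are asked to be distinct because [h] is not
    assumed irreflexive. *)
Lemma nonrepetitive_proper (f : V -> C) x y :
  nonrepetitive h f -> h x y -> x != y -> f x <> f y.
Proof.
move=> nr_f hxy x_neq_y fxy; apply: (nr_f 1 [:: x; y]) => //=.
  by rewrite /is_gpath /= inE x_neq_y hxy.
by rewrite fxy.
Qed.

End NonrepetitiveBasics.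

(** * Labellings and the certificate language *)

Notation cell := (int * int)%type.

(* A partial coloring by labels 0, 1, 2, ...: equal labels stand for equal
   colors and distinct labels for distinct ones. *)
Definition labelling := seq (cell * nat).

(* [Rep w] claims a repetitive path through the cell labelled last.  The digits
   of w are moves in the layout of a numeric keypad: those before the digit 5
   lead from that cell back to one end of the path, those after it to the other.
   [Pat j s x y] claims an occurrence of the j-th excluded pattern, transformed
   by the s-th symmetry of the square, with its first cell at (x, y).
   [Split x y cs] branches on the label of (x, y); the labels borne by adjacent
   cells are skipped, and as long as labels remain the last branch takes a new
   one. *)
Inductive cert :=
| Rep of Decimal.uint
| Pat of nat & nat & int & int
| Split of int & int & seq cert.

(** Through the number notation below, a bare numeral inside a certificate is a [Rep] leaf whose
    digits are the moves. *)
Definition cert_of_uint (w : Number.uint) : option cert :=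
  if w is Number.UIntDecimal w' then Some (Rep w') else None.

Definition uint_of_cert (c : cert) : option Number.uint :=
  if c is Rep w then Some (Number.UIntDecimal w) else None.

Declare Scope cert_scope.
Delimit Scope cert_scope with cert.
Bind Scope cert_scope with cert.
Number Notation cert cert_of_uint uint_of_cert : cert_scope.

Arguments Pat (j s)%_N (x y)%_Z.
Arguments Split (x y)%_Z cs.

(** * Decoding of paths and symmetries of the square *)

Definition push (d : cell) (p : seq cell) : seq cell :=
  if p is u :: _ then (u + d)%R :: p else p.

(** The growing end is kept at the head of the list, so the reversal at digit 5 brings the starting
    cell back to the head and later moves extend the path there. That the result is a path of the
    graph is left to [repetitive]. *)
Fixpoint decode (w : Decimal.uint) (p : seq cell) : seq cell :=
  match w with
  | Decimal.Nil => p
  | Decimal.D1 w' => decode w' (push (-1, -1)%Z p)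
  | Decimal.D2 w' => decode w' (push (0, -1)%Z p)
  | Decimal.D3 w' => decode w' (push (1, -1)%Z p)
  | Decimal.D4 w' => decode w' (push (-1, 0)%Z p)
  | Decimal.D5 w' => decode w' (rev p)
  | Decimal.D6 w' => decode w' (push (1, 0)%Z p)
  | Decimal.D7 w' => decode w' (push (-1, 1)%Z p)
  | Decimal.D8 w' => decode w' (push (0, 1)%Z p)
  | Decimal.D9 w' => decode w' (push (1, 1)%Z p)
  | Decimal.D0 w' => p
  end.

(** Every s from 7 on denotes the eighth symmetry, so that invariance of adjacency can be stated for
    all s. *)
Definition symmetry (s : nat) (u : cell) : cell :=
  let: (x, y) := u in
  match s with
  | 0 => (x, y)
  | 1 => (- x, y)
  | 2 => (x, - y)
  | 3 => (- x, - y)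
  | 4 => (y, x)
  | 5 => (- y, x)
  | 6 => (y, - x)
  | _ => (- y, - x)
  end%R.

(** The symmetries fix the origin, so [u0] is sent to [v]. *)
Definition place (s : nat) (u0 v u : cell) : cell := (symmetry s (u - u0) + v)%R.

Fixpoint label (e : labelling) (u : cell) : option nat :=
  if e is (v, a) :: e' then if v == u then Some a else label e' u else None.

(** * The certificate checker and the statement it certifies *)

Section Checker.

Variables (adj : rel cell) (K : nat) (pats : seq (nat * labelling)).

(** All cells must be labelled: two missing labels would compare as equal and yet say nothing about
    the colors. *)
Definition repetitive (e : labelling) (p : seq cell) : bool :=
  let ls := map (label e) p in
  let h := (size p)./2 in
  [&& 0 < h, size p == 2 * h, all isSome ls, take h ls == drop h ls
    & is_gpath adj p].

(** The first cell listed with label a stands for that label; the default is returned only if no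
    cell bears it. *)
Definition rep_cell (e : labelling) (a : nat) : cell :=
  (nth ((0, 0)%R, 0) e (index a (map snd e))).1.

(** A pattern occurs up to an injective renaming of its labels. The list [ls] is this renaming, read
    off at the representatives, and the last condition asks every cell of [q] to follow it. *)
Definition occurs (e : labelling) (m : nat) (q : labelling) (t : cell -> cell) :=
  let ls := [seq label e (t (rep_cell q a)) | a <- iota 0 m] in
  [&& all isSome ls, uniq ls
    & all (fun ua => (ua.2 < m) && (label e (t ua.1) == nth None ls ua.2)) q].

Definition clash (e : labelling) (v : cell) (a : nat) : bool :=
  has (fun ub => [&& ub.2 == a, adj ub.1 v & ub.1 != v]) e.

(** Labels not yet in use are interchangeable, so one branch covers all of them; there is none once
    [K] labels are in use. The order is the one in which the branches of a certificate are
    listed. *)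
Definition candidates (e : labelling) (m : nat) (v : cell) : seq nat :=
  [seq a <- iota 0 m | ~~ clash e v a] ++ (if m < K then [:: m] else [::]).

(** The number m counts the labels in use, which are those below m. An index outside [pats] gives an
    empty pattern and is rejected. *)
Fixpoint check (c : cert) (m : nat) (e : labelling) : bool :=
  match c with
  | Rep w => if e is (u, _) :: _ then repetitive e (decode w [:: u]) else false
  | Pat j s x y =>
      let: (n, q) := nth (0, [::]) pats j in
      if q is (u0, _) :: _ then occurs e n q (place s u0 (x, y)) else false
  | Split x y cs =>
      (* Lists of different lengths fail [all2], so every candidate has its branch. The maximum is m
         for an old label and m + 1 for the new label m. *)
      all2 (fun c' a => check c' (maxn m a.+1) (((x, y), a) :: e))
           cs (candidates e m (x, y))
  end.

End Checker.

(** The certificates below a split sit in a list, and the generated induction principle gives no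
    hypothesis on them. Here [foldr] states it for each element. *)
Lemma cert_nested_ind (Q : cert -> Prop) :
  (forall w, Q (Rep w)) -> (forall j s x y, Q (Pat j s x y)) ->
  (forall x y cs, foldr (fun c => and (Q c)) True cs -> Q (Split x y cs)) ->
  forall c, Q c.
Proof.
move=> Qrep Qpat Qsplit; fix IH 1 => -[w|j s x y|x y cs]; [exact: Qrep|exact: Qpat|].
by apply: Qsplit; elim: cs => //= c cs IHcs; split.
Qed.

(** The entry of [cols] at position a is the color that label a stands for. Wherever this is used,
    [cols] has no repeats, so distinct labels stand for distinct colors. *)
Definition realizes k (f : cell -> 'I_k) (cols : seq 'I_k) (e : labelling) :=
  forall u a, (u, a) \in e -> onth cols a = Some (f u).

(** The pattern stands at a fixed place; its images under symmetries and translations are reached by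
    composing [f] with them. The component [pat.1] is the number of labels of the pattern. *)
Definition unrealizable (adj : rel cell) (K : nat) (pat : nat * labelling) :=
  forall k (f : cell -> 'I_k) cols, k <= K -> nonrepetitive adj f ->
  uniq cols -> size cols = pat.1 -> ~ realizes f cols pat.2.

Lemma label_mem (e : labelling) u a : label e u = Some a -> (u, a) \in e.
Proof.
elim: e => //= -[v b] e IHe; case: eqP => [-> [->]|_ /IHe ue]; rewrite inE ?eqxx //.
by rewrite ue orbT.
Qed.

(** * Soundness of the checker *)

Section Soundness.

Variables (adj : rel cell) (K : nat) (pats : seq (nat * labelling)).
Hypothesis adj_place : forall s u0 v, {homo place s u0 v : x y / adj x y}.
Hypothesis pats_unrealizable : forall q, q \in pats -> unrealizable adj K q.

Section Coloring.

Variables (k : nat) (f : cell -> 'I_k).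
Hypotheses (k_le : k <= K) (nr_f : nonrepetitive adj f).

Let color (cols : seq 'I_k) (o : option nat) := obind (onth cols) o.

Lemma color_label cols e u :
  realizes f cols e -> label e u -> color cols (label e u) = Some (f u).
Proof. by move=> fe; case E: label => [a|] //= _; apply/fe/label_mem. Qed.

(** Equal labels stand for equal colors, so a path whose labels repeat also has repeating colors. *)
Lemma repetitive_false cols e p : realizes f cols e -> ~~ repetitive adj e p.
Proof.
move=> fe; apply/and5P=> -[h_gt0 /eqP size_p lab_p /eqP rep_p p_path].
(* Colors are compared under [Some], since reading a label and its color are partial operations. *)
apply: (nr_f h_gt0 size_p p_path); apply: (inj_map (@Some_inj _)).
have fE : {in p, forall u, Some (f u) = color cols (label e u)}.
  move=> u pu; rewrite color_label //.
  by rewrite all_map in lab_p; apply: (allP lab_p).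
have mapE (s : seq cell) : {subset s <= p} ->
    map Some (map f s) = map (color cols) (map (label e) s).
  by move=> sp; rewrite -!map_comp; apply/eq_in_map => u /sp /fE.
rewrite !mapE; [|by move=> u /mem_drop|by move=> u /mem_take].
by rewrite map_take map_drop rep_p.
Qed.

(** The coloring [f \o t] is again nonrepetitive with the same colors. If [q] occurred along [t],
    this coloring would realize [q] itself, with the colors of the representatives as list of
    colors. *)
Lemma occurs_false cols e n q t :
  (n, q) \in pats -> injective t -> {homo t : x y / adj x y} ->
  uniq cols -> realizes f cols e -> ~~ occurs e n q t.
Proof.
move=> q_pat t_inj t_hom uniq_cols fe; apply/and3P => -[lab_ls uniq_ls q_ls].
set lab := fun a => label e (t (rep_cell q a)) in lab_ls uniq_ls q_ls.
have labE a : a < n -> color cols (lab a) = Some (f (t (rep_cell q a))).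
  move=> a_n; apply: color_label => //.
  by rewrite all_map in lab_ls; apply: (allP lab_ls); rewrite mem_iota.
pose cols' := [seq f (t (rep_cell q a)) | a <- iota 0 n].
apply: (pats_unrealizable q_pat k_le (nonrepetitive_comp t_inj t_hom nr_f)
          (cols := cols')).
(* If the images of the representatives of a and b share a color, their labels in [e] agree because
   [cols] has no repeats, and then a = b because [ls] has none. *)
- rewrite map_inj_in_uniq ?iota_uniq // => a b.
  rewrite !mem_iota /= !add0n => a_n b_n fab.
  have := labE _ a_n; have := labE _ b_n; rewrite -fab.
  case Eb: (lab b) => [b'|] //=; case Ea: (lab a) => [a'|] //= cb ca.
  apply/eqP; rewrite -(nth_uniq None _ _ uniq_ls) ?size_map ?size_iota //.
  rewrite !(nth_map 0) ?size_iota // !nth_iota //= !add0n -/(lab a) -/(lab b).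
  have a'_lt : a' < size cols by rewrite -onthTE ca.
  by rewrite Ea Eb (onth_inj cols a' b') ?gtn_min ?a'_lt ?orbT // ca cb.
- by rewrite size_map size_iota.
(* The image of u bears the same label as the image of the representative of a, hence has the same
   color. *)
move=> u a uq; have /andP[/= a_n /eqP lab_u] := allP q_ls _ uq.
rewrite (nth_map 0) ?size_iota // nth_iota // add0n in lab_u.
rewrite onthE (nth_map (f u)) ?size_map ?size_iota //.
rewrite (nth_map 0) ?size_iota // nth_iota // add0n -labE // -lab_u color_label //.
by rewrite lab_u; move: (labE _ a_n); rewrite /lab; case: label.
Qed.

(** A nonrepetitive coloring is proper, so leaving out the labels of adjacent cells never discards
    the true one. *)
Lemma clash_false cols e v a :
  realizes f cols e -> onth cols a = Some (f v) -> ~~ clash adj e v a.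
Proof.
move=> fe av; apply/hasP=> -[[u b] /fe ub /= /and3P[/eqP ba uv u_neq_v]].
by case: (nonrepetitive_proper nr_f uv u_neq_v); apply: Some_inj; rewrite -ub -av ba.
Qed.

Lemma place_inj s u0 v : injective (place s u0 v).
Proof.
move=> x y /addIr sxy; apply: (@addIr _ (- u0)%R); move: sxy.
move: (x - u0)%R (y - u0)%R => [x1 x2] [y1 y2] /=.
(* Seven case splits separate the eight symmetries; each coordinate of the image is a coordinate of
   the argument up to sign. *)
by do 7?[case: s => [|s]] => /= -[]; do 2![do ?move/oppr_inj; move=> ->].
Qed.

(** At each split the actual color of the cell selects one of the branches, and following these
    choices leads to a leaf whose claim is false of [f]. The invariant is that the number of labels
    in use equals [size cols]. *)
Lemma check_false c cols e :
  uniq cols -> realizes f cols e -> ~~ check adj K pats c (size cols) e.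
Proof.
elim/cert_nested_ind: c cols e => [w|j s x y|x y cs IHcs] cols e uniq_cols fe /=.
- case: e fe => // -[u a] e fe; exact: repetitive_false fe.
- case E: nth => [n [|[u0 a] q]] //.
  (* Beyond the end of [pats] the default has an empty labelling, contrary to the shape found in
     [E]. *)
  have [j_lt|j_ge] := ltnP j (size pats); last by rewrite nth_default in E.
  apply: (occurs_false _ (@place_inj s u0 (x, y)) _ uniq_cols fe) => //.
  by rewrite -E mem_nth.
set v := (x, y).
(* The label b stands for the color of [v]; [cols'] is [cols], with that color appended if it is
   new. *)
have [b [cols' [b_cand uniq' size' fe']]] : exists b cols',
    [/\ b \in candidates adj K e (size cols) v, uniq cols',
        size cols' = maxn (size cols) b.+1 & realizes f cols' ((v, b) :: e)].
  have [/onthP[b bv]|v_new] := boolP (f v \in cols).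
    have b_lt : b < size cols by rewrite -onthTE bv.
    exists b, cols; split=> //; last 2 first.
    - by rewrite (maxn_idPl b_lt).
    - by move=> u a; rewrite inE => /predU1P[[-> ->] //|/fe].
    by rewrite mem_cat mem_filter mem_iota b_lt (clash_false fe bv).
  have uniq' : uniq (rcons cols (f v)) by rewrite rcons_uniq v_new.
  exists (size cols), (rcons cols (f v)); split=> //.
  (* The extended list consists of distinct colors among k, and k is at most [K]. Hence
     [size cols < K], and the branch for a new label is present. *)
  - rewrite mem_cat (leq_trans _ k_le) ?inE ?eqxx ?orbT //.
    have := max_card (mem (rcons cols (f v))).
    by rewrite (card_uniqP uniq') card_ord size_rcons.
  - by rewrite size_rcons (maxn_idPr _).
  move=> u a; rewrite inE -cats1 onth_cat => /predU1P[[-> ->]|/fe ua].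
    by rewrite ltnn subnn.
  by rewrite -onthTE ua.
(* Branches and candidates are walked through together until b is reached; the check fails there by
   induction, so [all2] fails. *)
elim: cs (candidates _ _ _ _ _) IHcs b_cand => [|c cs IH] [|a ls] //= [IHc IHcs].
rewrite inE negb_and => /orP[/eqP <-|b_ls]; last by rewrite (IH _ IHcs b_ls) orbT.
by rewrite -size' IHc.
Qed.

End Coloring.

(** A pattern excluded in this way can itself be put into [pats] for the next certificate. *)
Lemma check_sound c m e :
  check adj K pats c m e -> unrealizable adj K (m, e).
Proof.
move=> chk k f cols k_le nr_f uniq_cols /= size_cols fe.
by have := check_false k_le nr_f c uniq_cols fe; rewrite size_cols chk.
Qed.

End Soundness.

(** * Invariance of the two products under the symmetries *)

Lemma P_adjDr c i j : P_adj (i + c)%R (j + c)%R = P_adj i j.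
Proof. by rewrite /P_adj opprD addrACA subrr addr0. Qed.

Lemma P_adjN i j : P_adj (- i)%R (- j)%R = P_adj i j.
Proof. by rewrite /P_adj -opprD normrN. Qed.

Lemma cart_place s u0 v : {homo place s u0 v : x y / cart_adj P_adj P_adj x y}.
Proof.
case: u0 v => [a b] [c d] [x1 x2] [y1 y2].
(* The symmetries that swap the coordinates exchange the two kinds of edges, whence [orbC]. *)
by do 7?[case: s => [|s]]; rewrite /cart_adj /=
  !(inj_eq (addIr _), inj_eq oppr_inj, P_adjDr, P_adjN) // orbC.
Qed.

Lemma strong_place s u0 v : {homo place s u0 v : x y / strong_adj P_adj P_adj x y}.
Proof.
case: u0 v => [a b] [c d] [x1 x2] [y1 y2].
(* Swapping the coordinates exchanges the first two kinds of edges and the two factors of the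
   diagonal kind. *)
by do 7?[case: s => [|s]]; rewrite /strong_adj /=
  !(inj_eq (addIr _), inj_eq oppr_inj, P_adjDr, P_adjN) // orbCA [P_adj x2 _ && _]andbC.
Qed.

(** * Certificates for the Cartesian product *)

Local Notation P := Pat.
Local Notation S := Split.
Local Open Scope cert_scope.

(** The tree extends the labelling [tee] below, and all its leaves are repetitive paths. In the
    first one, (5, 6) bears label 1, and 6526 decodes to (6, 5), (5, 5), (5, 6), (6, 6) with labels
    1, 0, 1, 0. *)
Definition tee_cert : cert :=
  S 5 6 [:: 6526; S 7 6 [:: 4524; 2544; S 6 7 [:: 5226; 5242; 5262; S 5 4 [:: 5866; 5886; S 7 4
  [:: 5844; S 6 4 [:: 68854886; S 4 5 [:: 5666; 5686; S 4 6 [:: 5262; S 4 4 [:: 6586; 6588; S 8 5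
  [:: 5444; S 8 6 [:: 5242; 24544442; 25422448]; 5484; S 8 4 [:: 54884424; S 7 3 [:: 58884424; S 6
  3 [:: 658888; 5686; S 5 3 [:: 6588; 8566; 6584; 6586]]; S 8 3 [:: 588442; S 6 3 [:: 588662; S 5
  3 [:: 5884; 5848; 5688]; S 5 3 [:: 5884; S 6 2 [:: 58488842; S 7 2 [:: S 5 2 [:: 8566; 6586;
  6588; 5668488442]; 5484; 584844]; 5866; 5886]; 5686]]; 548444]; S 6 3 [:: 588662; 6588; 6586;
  6584]]; 854444]]; 8566]; 25622668]; S 8 4 [:: 54884422; S 8 6 [:: S 8 5 [:: 8542; 4584; S 8 7
  [:: S 7 7 [:: 56244242; S 7 3 [:: 58884422; S 6 3 [:: 658888; 5686; S 8 3 [:: 588442; 4584;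
  8544; 4588]]; S 4 4 [:: 56868668; S 6 3 [:: 568888; 658448; S 5 3 [:: 65888666; S 4 3 [::
  588662; 8566; 6586; 6588]; 5686]]; 856662]; S 6 3 [:: 588662; 6588; 6586; 6584]]]; S 7 7 [::
  56244422; 42456222]; 5244; 5224]]; S 8 5 [:: 8524; 2584; S 6 3 [:: 588668; S 5 3 [:: 65886862;
  568668; 5688]; S 7 3 [:: 4588; 4586; S 5 3 [:: 65888662; S 4 4 [:: 56886622; S 4 3 [:: 588662;
  8566; 6586; 6588]; 856626]; 5686]; 4584]; S 7 3 [:: 45888442; S 8 3 [:: 588442; 4584; 8544;
  4588]; 5484]]]; S 8 5 [:: 5484; 852448]; 54224488]; S 4 4 [:: 56886622; S 5 3 [:: 58886622; S 6
  3 [:: 458888; S 7 3 [:: 4588; 8544; 4586; 4584]; 5484]; S 8 5 [:: 5444; S 8 6 [:: 5242; S 4 3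
  [:: 588662; S 6 3 [:: 588442; S 7 3 [:: 5886; 5868; 5488]; S 7 3 [:: 5886; S 6 2 [:: 58688862; S
  5 2 [:: S 7 2 [:: 8544; 4588; 4584; 5448688662]; 5686; 586866]; 5844; 5884]; 5484]]; 568666];
  25422448]; 524442]; S 6 3 [:: 588442; 4588; 4586; 4584]]; 856666]; S 8 5 [:: 5444; 5244;
  5484]]]]; 5884; S 6 4 [:: 48568848; S 8 5 [:: 5444; S 8 4 [:: 58484422; S 8 6 [:: 52484422; S 7
  7 [:: S 8 7 [:: 5222; 5424; 5442]; S 8 7 [:: 522442; 4522; 4524; 2544]; 42522244]; 522448]; S 8
  6 [:: 52484422; S 8 7 [:: 522442; S 7 7 [:: S 9 5 [:: 54484422; 5488; S 9 6 [:: 254442; 5242; S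
  9 7 [:: 25444242; 5422; S 7 3 [:: S 6 3 [:: 56884886; 56888486; 5688]; 58688684; S 6 3 [::
  588668; 6588; 6584; 6586]; 58686884]]]; 542444]; 5622]; S 7 7 [:: 6524; 6526; 42522244]; S 7 7
  [:: 6542; 4562; 42522244]]; 452244]]; 5484; S 8 6 [:: 5242; S 8 4 [:: 4584; 4588; 8544; S 7 7
  [:: S 8 7 [:: S 4 5 [:: 5666; 5686; S 4 6 [:: 5262; 26566668; S 4 4 [:: 6586; S 7 8 [:: S 6 8
  [:: 56242266; 62522226; S 5 8 [:: 566226; S 8 8 [:: 54242266; 5444; S 9 5 [:: 5442; S 9 6 [::
  544884; 2548; 2544; 4524]; 548884; 5424]]; S 5 7 [:: 8526; 26566622; 2586]; S 5 7 [:: 8566;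
  26566622; 6586]]]; S 6 8 [:: 5626; 65266224; S 8 8 [:: 4524; 4522; 2544; S 5 7 [:: S 5 3 [::
  5884; 5848; S 6 3 [:: S 7 3 [:: 548848; S 4 3 [:: 5666; 5686; S 8 3 [:: 5444; S 6 2 [:: 588848;
  S 7 2 [:: 4584; 4586; 45884424; 4588]; 584888; S 5 2 [:: 5866; S 7 2 [:: 5844; 4858886888; S 4 2
  [:: 885668; 58686622; 885666]]; 5886]]; 5484]]; 5868]; 4588; 4584; 4586]; S 4 3 [:: 8568688886;
  568666; S 4 7 [:: S 9 5 [:: 5442; S 9 4 [:: 8544484486; 544442; 5848]; S 9 4 [:: 4584844448;
  584888; S 7 9 [:: 5226; S 6 3 [:: 5486888868; 4458668888; S 7 3 [:: 5886; S 8 3 [:: 4584484486;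
  854488; S 9 3 [:: 85448868; 8544; 4588; 4584]]; 5484]]; S 8 9 [:: 4522242248; 522226; 5424];
  5262]]; 5424]; 5626; 65226224]]]; 26566622; S 5 8 [:: 522226; 6252242266; 2566; 6526]]]]; 5224;
  5242]; 8566; 6588]]; S 4 4 [:: 56886686; S 4 6 [:: 26566866; S 4 7 [:: 526622; S 5 7 [:: 4526;
  4524; S 3 5 [:: 56686866; S 3 6 [:: 566622; 2568; 56666684; 6526]; 56626688; 56688666]];
  52666684; 5222]; S 5 7 [:: S 4 7 [:: S 7 8 [:: S 6 8 [:: 56242266; 62522226; 62524422]; S 6 8
  [:: 5626; 65266224; 62522442]; 5224; 5244]; 5626; 5666]; 66652242; 66652248]]; 58626688]]; 5424;
  5442]; S 7 3 [:: 5886; S 6 3 [:: 658884; 56888842; S 5 3 [:: S 4 3 [:: 56886684; 56888662; 5688;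
  56668868]; 5668; 5686]]; S 6 3 [:: S 5 7 [:: S 4 7 [:: S 4 6 [:: 58662266; 562262; S 4 5 [::
  5666; 5686; S 4 4 [:: 6586; S 8 7 [:: 544442; S 5 8 [:: S 6 8 [:: 5424; 42522226; S 4 8 [::
  6526; 2222566266; 2566; 6522]]; 5226; 52662268; 5262]; 4524; 4522]; 8566; 6588]]]; 5626;
  56662268; 5662]; 526222; 522262]; 6588; 6584; 6586]; 5868]; 42522244]]; 25422448]]]]; S 7 4 [::
  5844; S 6 4 [:: 68548868; S 4 5 [:: 5666; 5686; S 4 4 [:: 58686622; S 4 6 [:: 52686622; S 5 7
  [:: S 4 7 [:: 5626; 5222; 5662]; S 4 7 [:: 522662; 6526; 6522; 2566]; 62522266]; 522668]; S 4 6
  [:: 52686622; S 4 7 [:: 522662; S 5 7 [:: 4526; 4524; 62522266]; S 5 7 [:: S 3 5 [:: 56686622;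
  5688; S 3 6 [:: 256662; 5262; S 3 7 [:: 25666262; 5622; S 7 7 [:: S 5 3 [:: S 6 3 [:: 54886886;
  54888686; 5488]; 58488486; 58484886; S 6 3 [:: 588448; 4588; 4586; 4584]]; 24544424;
  24544442]]]; 562666]; 5422]; S 5 7 [:: 4562; 6542; 62522266]]; 652266]]; S 4 6 [:: 5262; S 4 4
  [:: 6586; 6588; S 5 7 [:: S 4 7 [:: 5626; S 8 5 [:: 5444; S 8 6 [:: 5242; 24544448; S 8 4 [::
  4584; S 5 8 [:: S 6 8 [:: 54226266; S 7 8 [:: 544224; S 4 8 [:: 56226266; 5666; S 3 5 [:: 5662;
  S 3 6 [:: 566886; 2566; 2568; 6526]; 5626; 568886]]; S 7 7 [:: 8524; 24544422; 2584]; S 7 7 [::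
  8544; 24544422; 4584]]; 42522224]; 5226; S 6 8 [:: 5424; 45244226; S 4 8 [:: 6526; 6522; 2566; S
  7 7 [:: S 7 3 [:: 5886; 5868; S 6 3 [:: S 5 3 [:: 568868; 5848; S 4 3 [:: 5666; S 8 3 [:: 5444;
  5484; S 6 2 [:: 588868; 586888; S 5 2 [:: 6586; 6584; 65886626; 6588]; S 5 2 [:: 5866;
  6858884888; S 7 2 [:: 5844; S 8 2 [:: 885448; 885444; 58484422]; 5884]]]]; 5686]]; 6588; 6586;
  6584]; S 8 3 [:: 8548488884; S 8 7 [:: S 3 5 [:: 5662; S 3 4 [:: 8566686684; 566662; 5868];
  5626; S 3 4 [:: 6586866668; 586888; S 5 9 [:: 5224; S 6 3 [:: 5684888848; 6658448888; S 5 3 [::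
  5884; S 4 3 [:: 6586686684; 856688; S 3 3 [:: 85668848; 8566; 6586; 6588]]; 5686]]; S 4 9 [::
  6522262268; 522224; 5626]; 5242]]]; 45224226; 5424]; 548444]]; 24544422; S 7 8 [:: 522224;
  4252262244; 2544; 4524]]]]; 5262]; 8544; 4588]]; 5484; S 8 4 [:: 54884484; S 8 6 [:: 24544844; S
  8 7 [:: 524422; 52444486; S 7 7 [:: 6524; 6526; S 9 5 [:: 54484844; S 9 6 [:: 544422; 54444486;
  2548; 4524]; 54488444; 54424488]]; 5222]; S 7 7 [:: S 8 7 [:: S 5 8 [:: S 6 8 [:: 54262266;
  42526622; 42522224]; 5226; S 6 8 [:: 5424; 45244226; 42522662]; 5266]; 5424; 5444]; 44452262;
  44452268]]; 58424488]]; 5662]; S 5 3 [:: 5884; S 6 3 [:: 458886; 54888862; S 7 3 [:: S 7 2 [::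
  58884486; 5888; 58888442; 58448848]; 5448; 5484]]; 5848; S 6 3 [:: S 7 7 [:: S 8 7 [:: S 8 6 [::
  58442244; 542242; S 8 5 [:: 5444; S 8 4 [:: 4584; S 4 7 [:: 566662; 6526; S 5 8 [:: 526662;
  5224; 5242; S 7 8 [:: S 6 8 [:: 4526; S 8 8 [:: 4524; 2544; 2222544244; 4522]; 62522224];
  52442248; 5224; 5242]]; 6522]; 8544; 4588]; 5484]]; 54442248; 5424; 5442]; 524222; 522242];
  4588; 4586; 4584]]; 62522266]; 8566]; 25622668]]]; 5884; S 6 4 [:: 4568; S 4 4 [:: S 4 5 [::
  2566; 2568; S 4 3 [:: 58866684; 58868662; 5886; 5868]; 6526]; S 4 5 [:: 5686; S 8 5 [:: 5444; S
  8 6 [:: 52484424; S 4 6 [:: 52686626; 26566662; S 8 7 [:: 522442; S 7 7 [:: S 8 4 [:: 58484424;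
  5888; S 5 3 [:: 58886866; S 6 3 [:: 458884; S 7 3 [:: 45888842; S 9 5 [:: 54484424; 5488; S 9 6
  [:: 254442; 5242; S 9 7 [:: 25444242; 5422; 45242242]]; 542442]; 5844]; 5484]; 5866; S 6 3 [::
  588668; 548488; S 7 3 [:: 4588; S 4 3 [:: 568848; S 8 3 [:: 4584484486; 84544448; 58424484];
  58626686]; 4584; 8544]]]]; 5622]; S 7 7 [:: 6524; 6526; S 5 3 [:: S 6 3 [:: 54868886; 48586888;
  5488]; S 6 3 [:: 458884; 58688842; 5484]; 5866; S 6 3 [:: 588668; 548488; S 7 3 [:: 4588; S 8 4
  [:: 58484424; 5424; S 4 3 [:: 568848; S 8 3 [:: 588488; 84544448; 58424484]; 58626686]]; 4584;
  8544]]]]; S 7 7 [:: 6542; 4562; S 5 3 [:: S 6 3 [:: 54868886; 48586888; 5488]; S 6 3 [:: 458884;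
  58688842; 5484]; 5866; S 6 3 [:: 588668; 548488; S 7 3 [:: 4588; S 8 4 [:: 58484424; 5424; S 4 3
  [:: 568848; S 8 3 [:: 588488; 84544448; 58424484]; 58626686]]; 4584; 8544]]]]]]; S 8 4 [::
  58484424; 885448; 445884]]; 5484; S 8 4 [:: 4584; S 8 6 [:: 5242; 5224; S 9 5 [:: 5442; 5424; S
  9 6 [:: S 9 4 [:: 5884; S 7 7 [:: S 8 7 [:: 44522442; 5424; 5226]; 42522266; 42522662]; 5848];
  54244248; 2544; 4524]; S 9 6 [:: 254444; 54244248; 54242448]]]; 8544; S 7 3 [:: 5886; S 6 3 [::
  658884; S 5 3 [:: 84856688; S 7 7 [:: S 8 7 [:: S 8 6 [:: 5242; 84452442]; S 8 6 [:: 5242; S 4 6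
  [:: 26566686; 26566668; S 8 3 [:: 4584484486; 854488; S 3 5 [:: 56686686; 56262666; 56266266; S
  3 4 [:: 856686; 856668; 5868]]]]]; 5424; 5442]; 42522224; 42522242]; 5866]; S 5 3 [:: 6588;
  8566; 6586; 84566868]]; 5844; 5868]]]; S 4 6 [:: 5262; 5226; S 5 3 [:: 5884; 5848; 5866; S 3 5
  [:: 5662; 5626; S 3 6 [:: 256666; 52666268; 52662668]; S 3 4 [:: S 3 6 [:: 6522; S 4 7 [:: S 5 7
  [:: 452262; S 2 5 [:: S 2 4 [:: 8566; S 2 6 [:: 5226; 5262; 6522668686]; 6586; 566866]; 5686;
  56668862; 5668]]; 5242; S 5 7 [:: 4526; S 4 3 [:: S 3 3 [:: 6586; S 2 4 [:: 5662; 5626; S 2 3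
  [:: 5868; S 6 3 [:: 588848; 85444486; S 7 3 [:: 4588; 85448484; 4584; 8544]]; 86566686];
  566866]; 6588; 568866]; 68588886; S 3 3 [:: 5686; S 2 4 [:: S 2 3 [:: 5866; 8568886666;
  85668666]; S 2 5 [:: 5262; 5686; 5668]; S 2 3 [:: 5868; S 6 3 [:: 588848; 86544448; S 7 3 [::
  4588; 85448484; 4584; 8544]]; 85666866]; 566866]; 5668]]; 4524]; 5224]; 2566; 6526]; S 5 7 [:: S
  4 7 [:: S 3 6 [:: S 5 8 [:: S 6 8 [:: 5424; 42522226; 45244226]; 5226; S 4 8 [:: 56262622;
  562244; 652222]; 5262]; 2568; 6522; 6526]; 5626; 5224]; 62522244; 62522442]; 5868]]]]]; 5666; S
  4 5 [:: 5666; 5686; S 4 6 [:: 5262; S 5 3 [:: 5884; S 3 5 [:: 5662; S 3 6 [:: 566622; 2566; S 4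
  7 [:: 526622; S 5 7 [:: 4526; 4524; S 3 4 [:: S 2 5 [:: S 2 6 [:: 5262; S 3 7 [:: 665242; 5626;
  245666]; 526666]; S 2 6 [:: 26566666; S 4 3 [:: S 2 4 [:: S 3 3 [:: 6584; S 2 3 [:: 5868; S 6 3
  [:: 458884; 85444486; S 7 3 [:: 4588; 8544; 4584; 85448484]]; 86566686]; 6586; 588666]; 5662;
  568666]; 68588886; S 3 3 [:: 5668; S 2 4 [:: S 2 3 [:: 5868; S 6 3 [:: 458884; 86544448; S 7 3
  [:: 4588; 8544; 4584; 85448484]]; 85666866]; S 2 3 [:: 5866; 658886; 85668666]; 568666]; 5686]];
  6526266686]; 5686; 5668]; 85688866; 5868]]; 5242; 5224]; 6526]; S 3 4 [:: S 3 6 [:: 256662; S 8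
  5 [:: 5444; S 4 7 [:: 526622; S 3 7 [:: 652226; 5626; 652262]; S 5 7 [:: S 7 7 [:: S 8 6 [::
  24544484; 24544444; S 8 4 [:: 54888444; 885448; 445884]]; 22254442; 44452224]; 5424]; S 5 7 [::
  4562; 6542; 65422262]]; 5484; 54244844]; 52662668]; 58666268; 58662668]; 5626]; 5866; 5848];
  5226]]]; S 8 4 [:: S 8 5 [:: 2544; S 8 3 [:: 58844486; 5884; 58848442; 5848]; 2548; 4524]; S 8 5
  [:: S 4 5 [:: 5666; 5686; S 4 6 [:: 52686626; S 8 6 [:: 52484424; 24544442; S 4 7 [:: 522662; S
  5 7 [:: 4526; 4524; S 7 3 [:: S 6 3 [:: 56848884; 68584888; 5688]; S 6 3 [:: 658886; 58488862;
  5686]; S 6 3 [:: 568868; 568688; S 5 3 [:: 6588; S 4 4 [:: 58686626; 5626; S 4 3 [:: 588688; S 8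
  3 [:: 548868; 84544448; 58424484]; 58626686]]; 8566; 6586]]; 5844]]; S 5 7 [:: S 4 4 [::
  58686626; 5888; S 7 3 [:: 58884844; S 6 3 [:: 658886; S 5 3 [:: 65888862; S 3 5 [:: 56686626;
  5688; S 3 6 [:: 256662; 5262; S 3 7 [:: 25666262; 5622; 65262262]]; 562662]; 5866]; 5686]; S 6 3
  [:: 568868; 568688; S 5 3 [:: 6588; S 4 3 [:: 6586686684; S 8 3 [:: 548868; 84544448; 58424484];
  58626686]; 8566; 6586]]; 5844]]; 5422]; S 5 7 [:: 4562; 6542; S 7 3 [:: S 6 3 [:: 56848884;
  68584888; 5688]; S 6 3 [:: 658886; 58488862; 5686]; S 6 3 [:: 568868; 568688; S 5 3 [:: 6588; S
  4 4 [:: 58686626; 5626; S 4 3 [:: 588688; S 8 3 [:: 548868; 84544448; 58424484]; 58626686]];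
  8566; 6586]]; 5844]]]]; S 4 4 [:: 58686626; 885668; 665886]]; S 4 4 [:: 6586; S 4 6 [:: 5262;
  5226; S 3 5 [:: 5662; 5626; S 3 6 [:: 256666; 56266268; 56262668]; S 3 6 [:: S 3 4 [:: 5886; S 5
  7 [:: S 4 7 [:: 66522662; 5626; 5224]; 62522244; 62522442]; 5868]; 56266268; 2566; 6526]]]; S 5
  3 [:: 5884; S 6 3 [:: 458886; S 7 3 [:: 44858684; S 5 7 [:: S 4 7 [:: S 4 6 [:: 5262; 86652662];
  5626; S 4 6 [:: 5262; S 8 6 [:: 24544484; 24544448; S 4 3 [:: 6586686684; 856688; S 9 5 [::
  54484484; 54242444; 54244244; S 9 4 [:: 854484; 5848; 854448]]]]]; 5662]; 62522226; 62522262];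
  5844]; S 7 3 [:: 4588; 8544; 86544848; 4584]]; 5848; 5866]; 8566]]; 5484; S 8 6 [:: 5242; 5224;
  S 7 3 [:: 5886; 5868; S 9 5 [:: 5442; 5424; S 9 4 [:: S 9 6 [:: 4522; S 8 7 [:: S 7 7 [::
  652242; S 10 5 [:: S 10 4 [:: 8544; 4584; S 10 6 [:: 5242; 5224; 4522448484]; 544844]; 5484;
  54448842; 5448]]; 5262; S 7 7 [:: 6524; S 8 3 [:: S 9 3 [:: 4584; 4588; S 10 4 [:: 5442; S 10 3
  [:: 5848; S 6 3 [:: 588868; 85666684; S 5 3 [:: 6588; 85668686; 8566; 6586]]; 84544484]; 5424;
  544844]; 548844]; 48588884; S 9 3 [:: 5484; 5448; S 10 4 [:: S 10 3 [:: 5844; 8548884444;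
  85448444]; S 10 3 [:: 5848; S 6 3 [:: 588868; 86566668; S 5 3 [:: 6588; 85668686; 8566; 6586]];
  85444844]; S 10 5 [:: 5242; 5484; 5448]; 544844]]]; 6526]; 5226]; 2544; 4524]; S 7 7 [:: S 8 7
  [:: S 9 6 [:: S 7 8 [:: S 6 8 [:: 5626; 65266224; 62522226]; S 6 8 [:: 56242422; 562626;
  562266]; 5224; 5242]; 2548; 4522; 4524]; 5424; 5226]; 42522266; 42522662]; 5848]; S 9 6 [::
  254444; 52444248; 52442448]]; 5844]]]; S 8 5 [:: 5444; 5484; S 8 6 [:: 5242; S 7 3 [:: 5886; S 9
  5 [:: 5442; S 9 6 [:: 544422; S 8 7 [:: 524422; 5262; S 7 7 [:: 6524; 6526; S 9 4 [:: S 10 5 [::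
  S 10 6 [:: 5242; S 9 7 [:: 445262; 5424; 265444]; 524444]; 5484; S 10 6 [:: 24544444; S 9 7 [::
  S 10 7 [:: 5244; 5224; 22544224]; 5424; S 10 7 [:: S 8 3 [:: S 10 4 [:: S 9 3 [:: 4586; 4584; S
  10 3 [:: 5848; S 6 3 [:: 658886; 85666684; S 5 3 [:: 6588; 8566; 85668686; 6586]]; 84544484];
  588444]; 5442; 548444]; 48588884; S 9 3 [:: 5448; 5484; S 8 8 [:: S 7 8 [:: 2456262222; S 6 8
  [:: 5662; 66522662; 5626]; 62522262]; 5224; 5242; S 9 8 [:: 4526; 522242; 4522; 4524]]]]; 5244;
  5224]]; 4524244486]; 5448]; 85488844; 5848]]; 5226]; 2544; 4524]; 5424; S 9 4 [:: S 9 6 [::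
  254442; S 4 5 [:: 5666; 5686; S 8 7 [:: 524422; S 7 7 [:: S 5 7 [:: S 4 6 [:: 26566686;
  26566666; S 4 4 [:: 56888666; 885668; 665886]]; 22256662; 66652226]; 5626]; S 9 7 [:: 452224;
  5424; 452242]; S 7 7 [:: 6542; 4562; 45622242]]; 56266866]; 52442448]; 58444248; 58442448]];
  5868; 5844]; 5224]]; 5444]]]]]]].

(** This extends [cross]; leaves [P 0] are occurrences of [tee]. *)
Definition cross_cert : cert :=
  S 5 4 [:: 5688; S 5 6 [:: 5622; S 7 4 [:: 5488; S 7 6 [:: 5422; 44252244; S 4 5 [:: 5666; S 6 3
  [:: S 4 4 [:: 5688; 586622; S 5 3 [:: 568844; 5866; S 4 6 [:: 5622; 526622; S 4 3 [:: 8566; S 3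
  4 [:: S 3 5 [:: 256668; 256686; P 0 5 4 4]; 5626; 5688; 5662]; 6588; 6586]]]]; 5888; P 0 2 5 4;
  58688442]; P 0 5 5 4; 56866224]]; S 7 6 [:: 5422; S 4 5 [:: 5666; S 6 7 [:: S 4 6 [:: 5622;
  526688; S 5 7 [:: 562244; 5266; S 4 4 [:: 5688; 586688; S 4 7 [:: 2566; S 3 5 [:: S 3 6 [::
  5686; 5622; 5668]; 566688; 566868; P 0 5 4 4]; 6522; 6526]]]]; 5222; P 0 0 5 6; 52622448]; P 0 5
  5 4; 56266884]; S 4 5 [:: 5666; S 6 3 [:: S 4 4 [:: 5688; 586622; S 4 6 [:: 5622; 526622; S 7 3
  [:: 548844; S 5 3 [:: 568844; P 0 0 5 3; S 4 3 [:: 8566; S 3 4 [:: S 3 5 [:: 256668; 256686; P 0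
  5 4 4]; 5626; 5688; 5662]; 6588; 6586]]; 548484]]]; 5888; S 7 3 [:: 5888; S 5 3 [:: 6588; 8566;
  6586; S 4 4 [:: 5688; S 4 3 [:: 588668; S 4 6 [:: 5622; 5222; S 3 3 [:: 56688486; 5688; 566686;
  S 4 2 [:: 58688486; 5888; 586686; P 0 2 3 3]]]; P 0 0 4 3]; 5626]]; 5484]; S 5 3 [:: 5888; S 7 3
  [:: 4588; 8544; 4584; S 4 4 [:: 5688; S 4 3 [:: 588668; 6588; 6586; 8566]; 856626]]; 5686]]; P 0
  5 5 4; S 4 4 [:: 5688; S 4 6 [:: 5622; S 3 4 [:: S 3 5 [:: P 0 5 4 4; S 3 6 [:: S 2 5 [:: P 0 5
  3 4; 56666862; 56668662; S 2 4 [:: S 2 6 [:: 66252266; 5622; 566626]; 5688; 566686]]; 52668662;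
  5622]; 526686]; S 3 5 [:: S 4 3 [:: S 3 3 [:: S 5 3 [:: P 0 0 3 3; S 6 3 [:: 8544; 4588; 4584;
  4586]; 548866]; 568686; 568866]; S 5 3 [:: 5888; 5484; S 3 3 [:: 6588; 6586; 566866; 8566]]; S 5
  3 [:: 4588; 4584; 4586; S 3 3 [:: S 3 6 [:: 5222; 25662242; 5622]; 5686; 5668]]; 5888]; P 0 5 4
  4; 526668]; S 3 5 [:: S 3 6 [:: S 4 3 [:: S 5 3 [:: 5844; S 6 3 [:: 8544; 4588; 4584; 4586];
  548866]; 58488662; P 0 2 3 4; 5888]; 66252266; 5622]; 5266; 25662668]; 5688]; 65262668];
  65868662]]]]; S 7 4 [:: 5488; S 7 6 [:: 5422; S 6 3 [:: S 8 5 [:: 5444; S 7 3 [:: 548866; 5844;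
  S 8 4 [:: 5488; 584422; S 5 3 [:: 568866; 5866; S 8 3 [:: 8544; S 6 2 [:: 588866; S 7 2 [::
  5488; 5868; 5886]; 588686; P 0 2 5 3]; 4588; 4584]]]]; P 0 4 7 4; 54844226]; 5888; P 0 2 5 4;
  58488662]; S 6 3 [:: S 4 5 [:: 5666; S 5 3 [:: 568844; 5866; S 4 6 [:: S 4 4 [:: P 0 4 4 4;
  586622; S 4 3 [:: 8566; S 3 4 [:: 568866; 5626; S 3 5 [:: 2568; 566622; 566262; 6526]; 5662];
  6588; 6586]]; 526622; 562226]]; S 4 6 [:: 5262; S 4 4 [:: 6586; 6588; 8566; S 5 3 [:: S 4 3 [::
  S 7 3 [:: 5444; 5844; S 3 3 [:: 5666; 56866268; 568868; S 4 2 [:: 5866; 58866268; 588868; P 0 5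
  4 2]]]; 566886; P 0 4 4 3]; 5866; 5848]]; 5666]; S 4 4 [:: 5868; S 4 6 [:: 6526; 6522; 2566; S 5
  3 [:: S 4 3 [:: 8566; 566886; 6586; 6588]; 5866; 658848]]; 5666]]; 5888; P 0 2 5 4; S 5 3 [::
  85686884; S 7 3 [:: 85484886; S 5 2 [:: S 6 2 [:: P 0 2 5 3; S 4 3 [:: S 4 4 [:: 5262; 5666; S 4
  2 [:: 6586; 8566; 568886; 6588]]; S 4 2 [:: S 4 4 [:: S 4 5 [:: 2566; 6522; 6526; 2568]; P 0 4 4
  2; 526688]; 568886; 586688]; S 4 4 [:: 2568; 6526; 2566; S 4 2 [:: 5868; S 7 2 [:: 5444;
  45884424; 5488]; 5886]]; 5666]; 548886]; S 6 2 [:: S 7 2 [:: S 6 1 [:: 58888684; P 0 2 5 2;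
  58886884; S 5 1 [:: 5688; S 7 1 [:: 5488; 44858844; 588848]; 588868]]; 54886884; 5844]; P 0 2 5
  3; 548868]; S 6 2 [:: 48586888; 5488; S 7 2 [:: S 4 3 [:: 56266884; S 4 4 [:: S 4 5 [:: 2566;
  6522; 6526; 2568]; 5622; 526688]; P 0 5 5 2; 5666]; 44858844; 5488]]; 5866]; 5844]; 5866]]]; S 7
  6 [:: 5422; 44252244; S 6 7 [:: S 8 5 [:: 5444; S 7 7 [:: 542266; 5244; S 8 6 [:: 5422; 524488;
  S 5 7 [:: 562266; 5266; S 8 7 [:: 2544; S 6 8 [:: 522266; S 7 8 [:: 5422; 5262; 5226]; P 0 0 5
  7; 522626]; 4522; 4524]]]]; 54244886; P 0 4 7 4]; 5222; 52422668; P 0 0 5 6]]]]].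

(** This extends [line]; leaves [P 0] refer to [tee] and [P 1] to [cross]. *)
Definition line_cert : cert :=
  S 6 4 [:: P 0 2 5 5; S 5 4 [:: 5866; S 5 6 [:: 5266; S 7 6 [:: 5244; S 6 6 [:: 4562; S 6 7 [::
  524226; P 1 0 5 6; P 0 0 5 6; S 5 7 [:: S 7 7 [:: S 4 5 [:: 5666; 5688; S 4 6 [:: 5262; 256622;
  S 4 4 [:: 6586; 566886; 8566; 6588]]; 56886622]; 524224; 5244]; 526224; 5266]]; S 5 7 [:: S 6 7
  [:: P 1 0 5 6; 5422; S 7 7 [:: 22544222; S 7 4 [:: 5844; S 6 3 [:: 588688; P 1 0 5 4; P 0 2 5 4;
  588868]; 548868]; 5244]]; S 7 4 [:: 5844; S 6 3 [:: 588488; P 1 0 5 4; P 0 2 5 4; 588848];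
  548848]; S 6 7 [:: 542226; P 1 0 5 6; P 0 0 5 6]; 5266]]; S 6 6 [:: P 0 0 5 5; S 7 4 [:: 5844; S
  6 3 [:: S 5 3 [:: 568848; 5866; S 7 3 [:: 548848; 5844; S 6 2 [:: 588848; P 1 0 5 3; 588488; P 0
  2 5 3]]]; P 1 0 5 4; P 0 2 5 4; S 7 3 [:: 5888; 548884; 5844]]; S 6 3 [:: S 7 3 [:: 548848; S 5
  3 [:: 568848; P 0 0 5 3; S 6 2 [:: 588848; P 0 4 6 2; 588488; S 5 2 [:: 6586; 58886862; 568688;
  6588]]]; 458884]; S 5 3 [:: S 7 3 [:: 54488668; 5488; S 4 4 [:: P 0 5 5 3; S 4 5 [:: 526626;
  5622; S 4 3 [:: 586626; 5688; S 3 4 [:: 566266; 566626; P 1 0 3 4; P 0 5 4 3]]]; P 1 0 4 4; S 4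
  5 [:: 5666; 526662; 5622]]]; 5688; 65886862]; S 7 3 [:: S 8 4 [:: P 0 4 7 3; 544884; P 1 0 6 4;
  S 8 5 [:: 5444; S 5 3 [:: 8566; S 4 4 [:: S 4 5 [:: 2566; 2568; 6526; S 8 3 [:: 54884442; S 6 2
  [:: S 7 2 [:: 45888444; 4586; 4584; 4588]; 5848; 5884; 588668]; 5488]]; 5626; 5662; 566668];
  6586; 568668]; 5422]]; 584884; 5484]; S 5 3 [:: S 7 3 [:: 8544; 548884; 4584; S 8 4 [:: S 8 5
  [:: 2544; S 4 4 [:: P 0 5 5 3; S 6 2 [:: S 4 3 [:: S 5 2 [:: 65888668; 6584; 6588; 6586]; 5688;
  5662]; 588884; 5886; 5868]; P 1 0 4 4; 56886626]; 2548; 4524]; 544884; 5442; 5424]]; 568884;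
  5686]]]]; S 6 6 [:: P 0 0 5 5; S 7 4 [:: 5844; S 6 3 [:: 584886; P 1 0 5 4; P 0 2 5 4; S 5 3 [::
  S 7 3 [:: 88854488; 584884; 5844]; 586884; 5866]]; S 6 3 [:: 584886; S 7 3 [:: 5888; 5488; S 6 7
  [:: 524226; S 7 7 [:: 5222; 45242262; 5422]; S 7 7 [:: 5222; 542224; 5424]; S 5 7 [:: 56226224;
  526224; 5626]]]; S 7 3 [:: 5888; 548884; 5484]; S 5 3 [:: S 4 4 [:: P 0 5 5 3; 566884; P 1 0 4
  4; S 4 5 [:: 5666; S 4 6 [:: 6526; 566224; 2566; 6522]; 5622]]; 586884; 5686]]]]]; S 6 6 [::
  5422; P 1 0 5 5; S 4 6 [:: 5622; S 4 4 [:: 5688; S 4 5 [:: S 3 5 [:: P 1 0 3 5; P 0 5 4 4;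
  562668; S 3 4 [:: 568662; 5688; S 3 6 [:: 562662; 5622; 66652266]]]; 2586; S 3 5 [:: P 1 0 3 5;
  P 0 5 4 4; S 3 4 [:: 568668; S 3 6 [:: 562668; 66522666; 5622]; 5688]; 568662]]; S 4 5 [:: 5266;
  S 7 4 [:: 5844; 5444; S 3 5 [:: S 3 4 [:: 85686626; 5666; 5866]; S 3 4 [:: 586668; 5666; 5868];
  S 3 6 [:: 562668; 52662668; 5262]; 568662]]]; S 4 5 [:: S 7 6 [:: 5244; 25442426; S 7 4 [::
  5844; 58844224; S 7 3 [:: S 8 5 [:: 5444; S 8 4 [:: P 0 4 7 3; 854488; 854444]; 54844224; 5422];
  S 6 7 [:: 522622; P 1 0 5 6; 522262; P 0 0 5 6]; S 6 3 [:: 588448; 6588; 6584; 6586]; 584448]]];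
  P 0 5 5 4]]; S 4 5 [:: 5666; P 0 5 5 4; S 7 4 [:: 5844; S 4 4 [:: 5688; S 7 6 [:: 5244; S 7 7
  [:: S 8 5 [:: 5444; 5488; 54244884; S 8 6 [:: P 0 4 7 5; 254422; 254444]]; S 6 3 [:: 588688; P 1
  0 5 4; P 0 2 5 4; 588868]; 524442; S 6 7 [:: 522442; 6522; 6526; 6524]]; 52244884]; 5666];
  85448486]]; S 4 5 [:: 5666; S 7 6 [:: 5244; S 4 4 [:: 5688; S 3 5 [:: S 3 6 [:: 25626686; 5266;
  5666]; S 3 6 [:: 526662; 5262; 5666]; 562668; S 3 4 [:: 568662; 5868; 58668662]]; 65868662];
  5444]; 5866]]]; S 6 6 [:: P 0 0 5 5; P 1 0 5 5; S 7 6 [:: 5244; S 5 3 [:: S 4 4 [:: P 0 5 5 3;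
  566886; P 1 0 4 4; S 4 5 [:: 5666; S 7 4 [:: 5844; S 6 3 [:: P 1 0 5 4; 5488; S 7 3 [::
  88544888; 584886; 5844]]; S 6 3 [:: S 7 3 [:: 44588448; 5488; 584448]; 5488; S 7 3 [:: 8544; S 8
  4 [:: S 8 5 [:: 2544; 2548; S 4 3 [:: 56886662; S 6 2 [:: S 5 2 [:: 65888666; 6584; 6588; 6586];
  5868; 5886; 588448]; 5688]; 4524]; 5424; 5442; 544448]; 4584; 548448]]]; 5622]]; 586886; S 7 4
  [:: 5844; 5442; S 6 3 [:: S 7 3 [:: 548868; P 0 0 5 3; S 6 2 [:: 588868; P 0 5 6 2; S 7 2 [::
  4584; 58884842; 548488; 4588]; 588688]]; 4588; 4584; 4586]]; S 6 3 [:: 548886; S 7 4 [:: 5844; P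
  1 0 5 4; S 7 3 [:: S 4 3 [:: 568886; S 6 2 [:: 58688448; 5888; S 5 2 [:: 658888; P 0 2 4 3;
  658866]; 5844]; S 8 4 [:: P 0 4 7 3; 544244; P 1 0 6 4; 544424]; S 4 4 [:: 2568; 566886; 2566;
  6526]]; 5488; 45884842]]; S 7 4 [:: 5844; P 0 2 5 4; S 7 3 [:: S 4 4 [:: S 4 5 [:: 2566; S 6 2
  [:: S 7 2 [:: 45888448; S 8 4 [:: P 0 4 7 3; S 8 3 [:: 5424; 5442; 5488]; P 1 0 6 4; 54884424];
  4584; 4588]; 588886; 5884; 5848]; 6526; 2568]; 566886; 5662; 5626]; 548886; 5484]]]]; S 6 7 [::
  S 5 7 [:: 562242; S 7 7 [:: 542242; S 6 8 [:: 522242; P 0 0 5 7; P 1 0 5 7; 522422]; 5244];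
  5266]; P 1 0 5 6; S 5 7 [:: S 7 7 [:: S 4 5 [:: 5666; 56886622; S 4 4 [:: 6586; 566888; 8566; S
  4 6 [:: 5262; 225662; 225668]]; 5688]; 542224; 5244]; 562224; 5266]; P 0 0 5 6]]]]]].

(** This extends [square]; leaves [P 0] refer to [line]. *)
Definition square_cert : cert :=
  S 5 4 [:: 5868; 5886; S 4 6 [:: P 0 0 4 6; S 7 5 [:: P 0 0 5 5; S 6 4 [:: P 0 4 6 4; S 7 4 [::
  548844; 4584; 8544; S 7 6 [:: 5424; S 6 3 [:: 588844; 5886; S 8 5 [:: 544844; 5442; S 4 4 [:: S
  4 5 [:: 2568; 6526; S 8 4 [:: 84544448; S 8 6 [:: 2544; 4522; 4524; S 4 3 [:: 58668862; S 7 7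
  [:: 52442242; S 6 7 [:: 5242; S 5 7 [:: 5626; 5662; S 5 3 [:: 6584; S 4 7 [:: 526626; S 8 7 [::
  S 3 4 [:: 56668862; S 3 5 [:: 5262; S 3 6 [:: 566626; 6522; 56622248; 6526]; 2566666884]; 5668;
  5686]; 22254444; P 0 0 6 7]; P 0 0 4 7]; 48588886]]; 65244222]; 5226; 5262]; 5868; 5886]];
  5848]]; S 4 5 [:: 2586; 8526; P 0 4 4 4]; 5662; S 4 5 [:: 5686; S 5 3 [:: 6588; S 7 3 [:: S 7 2
  [:: 58488862; S 6 2 [:: S 5 2 [:: 5668; 5686; S 8 4 [:: 84544224; 84544242; 5848]]; 5848; S 5 2
  [:: 566884; P 0 0 5 2; P 0 4 5 2]]; 58448848; P 0 4 7 2]; 5448; 5484]; 6586; 6584]]]; 5424];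
  5868]; 5224]]; S 7 4 [:: 584844; S 4 5 [:: 5686; S 4 4 [:: 6586; 6588; S 3 5 [:: 5662; S 3 6 [::
  566626; 2566; 6526; S 3 4 [:: 6588666226; 5868; 5886]]; 5626; S 3 4 [:: S 3 6 [:: P 0 4 3 4; P 0
  0 3 6; S 2 6 [:: S 2 5 [:: 86566662; S 5 7 [:: P 0 4 5 5; S 4 7 [:: 562626; 6526; 6524; S 6 7
  [:: 5424; 45244442; 5442]]; 522424; 52244486]; P 0 0 2 5]; 5662; S 2 5 [:: 58622666; S 2 4 [:: P
  0 0 2 4; 588666; S 1 5 [:: 56666624; S 1 4 [:: 5668; 5686; S 1 6 [:: 56622666; 6526; 6522; S 2 7
  [:: 52622666; 5224; 52626266; 5242]]]; 568666; P 0 0 1 5]]; P 0 0 2 5]; 5626]]; 86566668; P 0 0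
  3 4]]; 8566]; S 5 7 [:: P 0 4 5 5; S 4 7 [:: 562626; 6526; S 6 7 [:: 5424; 5442; S 3 6 [::
  566626; 5668; 5686; S 5 8 [:: 526222; 5224; 5242; S 4 8 [:: 62522262; 5626; S 4 4 [:: S 6 8 [::
  4522; 4524; 2544; S 3 4 [:: S 7 7 [:: 54224424; 5448; S 7 6 [:: 8522; P 0 4 7 5; 2584]; 5484];
  56886684; 5668; 5686]]; 5884; 65888862]]]]]; 6522]; S 6 7 [:: 5224; 5242; S 7 7 [:: S 7 6 [::
  8542; S 7 8 [:: S 4 4 [:: 56868688; P 0 4 4 4; 56866888]; S 6 8 [:: P 0 4 6 6; 62522442;
  56244224]; 5224; 5242]; 4584]; S 8 7 [:: 544222; 54424426; S 7 8 [:: 524222; 52424426; S 7 6 [::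
  P 0 4 7 6; S 8 6 [:: 5448; 5484; S 8 5 [:: 544844; 8542; 4588; 4584]]]; S 7 6 [:: S 8 6 [::
  8544; 4584; 8542; S 8 5 [:: 544844; P 0 0 6 5; P 0 4 8 5]]; P 0 4 7 6]]; P 0 0 6 7]; S 7 6 [::
  8522; P 0 4 7 5; 2584]; P 0 0 5 7]]; S 6 7 [:: 5224; 5242; S 6 3 [:: 588448; P 0 4 6 3;
  58488862; S 7 3 [:: 85488884; 5884; 5484]]]]]; P 0 0 5 4]]; S 7 6 [:: 5424; 5442; S 6 4 [:: P 0
  4 6 4; S 7 4 [:: 548844; S 4 5 [:: 5686; S 4 4 [:: 6586; 6588; 8566; S 5 3 [:: 5884; S 4 3 [::
  568866; 568668; P 0 4 4 3]; S 6 3 [:: 588844; 4586; 4584; S 7 3 [:: S 8 6 [:: P 0 0 6 6; S 8 5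
  [:: 854444; 854244; S 7 7 [:: S 6 7 [:: 6522; 6524; S 8 7 [:: S 5 7 [:: P 0 0 5 7; 22456662;
  66652224]; 5442; 5424]; 6526]; 5262; 52422268; 5226]]; 54422268; 5424244886]; 5848; 5884]];
  5848]]; S 4 4 [:: S 3 4 [:: S 3 5 [:: P 0 0 3 5; S 6 3 [:: 588844; P 0 4 6 3; S 7 3 [::
  45844448; 5484; S 5 3 [:: 6584; 566888; 6586; 8566]]; 58844426]; 26566668]; S 3 5 [:: P 0 0 3 5;
  52688666; S 2 5 [:: 562666; 56666684; S 2 4 [:: 8566; 56688666; 6586; S 3 3 [:: 58686866;
  58688666; 5884; 5848]]; P 0 0 2 5]]; 5668; 5686]; P 0 4 4 4; P 0 0 4 4]]; P 0 4 7 4]; S 4 4 [::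
  S 4 5 [:: 2568; 6526; S 7 7 [:: S 4 3 [:: 58866868; 58868668; 5868; 5886]; 522424; S 7 4 [::
  885444; S 8 5 [:: S 8 4 [:: 8485444884; 5484; 5448]; P 0 0 6 5; S 8 6 [:: P 0 0 6 6; 542244; S 8
  4 [:: S 5 7 [:: P 0 4 5 5; S 4 7 [:: 522662; 6526; S 6 7 [:: 5442; S 5 8 [:: 526222; 5224; 5242;
  S 6 8 [:: 4522; 4524; 4526; S 4 8 [:: 62522226; 5626; S 7 8 [:: 2544222266; 44452222; P 0 0 5
  8]]]]]; 6522]; 52626624; S 6 7 [:: 5224; 425626]]; 5484; 5448]]; S 8 6 [:: 2544; 542244; 2548;
  4524]]; 445888]; P 0 4 7 5]]; 566868; S 7 4 [:: 445884; S 6 3 [:: S 7 3 [:: 4845888444; 5884;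
  5848]; P 0 4 6 3; S 5 3 [:: P 0 4 5 3; 586688; S 7 3 [:: S 4 3 [:: S 4 5 [:: S 3 4 [::
  5626888662; S 3 5 [:: 5662; 5626; S 3 6 [:: 562666; P 0 0 3 6; S 5 7 [:: P 0 4 5 5; S 4 7 [::
  522666; 6526; 6524; S 6 7 [:: 5424; S 3 7 [:: 26566626; 5262; 52226666]; 5442]]; 524224;
  52622268]]]; P 0 0 3 4; 562666]; 685226]; S 4 5 [:: S 5 7 [:: P 0 4 5 5; S 4 7 [:: 522666; 6526;
  6522; S 3 6 [:: 562666; 5668; S 3 5 [:: 8566; 6586; 8562; S 3 4 [:: 6258686662; S 3 3 [::
  58866624; 6586; 588868; 6588]; P 0 0 3 4]]; 5686]]; 524222; 52622268]; 865226]; 5686]; 5884;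
  5848]]; S 5 3 [:: 6588; 568688; 6584; 6586]]; 885444]; P 0 0 4 4]]]; S 7 6 [:: 5424; 5442; S 7 4
  [:: S 6 4 [:: 658844; S 4 5 [:: 5686; S 4 4 [:: 6586; 6588; S 5 7 [:: P 0 4 5 5; S 6 7 [:: 5424;
  S 7 7 [:: 4524; 2544; S 5 3 [:: 5884; S 6 3 [:: 5868; 54888862; S 7 3 [:: 5448; S 4 3 [::
  88856668; P 0 0 4 3; S 4 7 [:: S 3 6 [:: 5686; 5668; 56226266; 56222666]; 6526; 2566;
  52222666]]; 5484]]; 5848; S 4 3 [:: S 8 6 [:: 5448; S 8 5 [:: 5424; 58444426; S 8 4 [:: 5884;
  84544442; 5848]]; 5484; 54224424]; 56886684; 5686]]; 4522]; 452226]; S 6 7 [:: 5224; 5242;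
  452622]; S 6 7 [:: 5224; 5242; S 6 3 [:: 5868; 5886; 58488862; S 5 3 [:: 6588; S 7 3 [:: 5448; S
  4 3 [:: 88856668; P 0 0 4 3; S 7 2 [:: P 0 4 7 2; S 6 2 [:: 65888862; S 5 2 [:: S 6 1 [:: S 7 1
  [:: 5484; 8548488886; 48588848]; 5868; 5886; 58844888]; 5686; 56844888]; 5884]; 58448488;
  58444888]]; 5484]; 6584; 6586]]]]; 8566]; 856626]]; S 6 4 [:: 6588; S 4 4 [:: S 4 5 [:: 2568;
  6526; S 3 5 [:: P 0 0 3 5; S 3 4 [:: S 3 6 [:: 566622; 6522; S 4 7 [:: 526622; S 6 7 [:: 5224;
  5242; S 5 7 [:: 4526; 4524; S 3 7 [:: 62522266; 5626; 5662]]; 52442248]; 5242; 5224]; 6526];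
  5668; 5686]; S 3 4 [:: 85666886; 5668; 5686]; S 3 6 [:: 566622; P 0 0 3 6; S 4 3 [:: S 5 3 [:: P
  0 4 5 3; 54866886; 48588668]; S 6 3 [:: 588844; P 0 4 6 3; S 7 3 [:: S 5 3 [:: 8566; S 4 7 [::
  526622; S 3 7 [:: 25622226; 5626; 5226]; 52622248; P 0 4 4 5]; 56688842]; 5484; 5884]; S 5 3 [::
  P 0 4 5 3; 456868]]; 5868; 5886]]]]; S 4 5 [:: 2586; 8526; P 0 4 4 4]; P 0 0 4 4; S 4 5 [::
  5686; S 8 5 [:: S 8 4 [:: 5448; S 8 6 [:: 445224; 225444; S 6 7 [:: 5224; 5242; S 5 7 [:: 5626;
  2456222668; S 4 7 [:: 526622; S 9 5 [:: 5424484486; S 9 6 [:: 5424; S 3 6 [:: 566622; P 0 0 3 6;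
  S 3 7 [:: S 7 7 [:: 4524; 54244486; S 8 7 [:: 5224; 25422244; 5242]; 2544]; 5626; 5662];
  5666666242]; 5442]; 5424448486; P 0 0 7 5]; P 0 0 4 7]]; 526622]]; 5484]; P 0 0 6 5; S 6 3 [::
  588844; P 0 4 6 3; S 5 3 [:: 6588; S 7 3 [:: S 8 4 [:: S 8 3 [:: 4584; 4588; 8544; S 6 2 [:: S 7
  2 [:: 4588; S 5 2 [:: 5668; 5686; S 8 2 [:: P 0 0 6 2; 88854448; S 4 3 [:: 6586666224; S 3 3 [::
  56688842; P 0 0 3 3; 566686; S 3 4 [:: S 3 5 [:: 5266666224; 56662268; 5626]; 56686684; 6526;
  2568]]; P 0 0 4 3]]]; 4584; 4586]; 5848; 5884; 58688842]]; 854424; 5484]; 5484; 5884]; 6586;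
  6584]; S 5 3 [:: 5884; 568686; S 4 3 [:: S 6 2 [:: S 5 2 [:: S 4 2 [:: S 3 4 [:: S 3 3 [:: S 3 5
  [:: 5226; S 3 2 [:: 5686; 68588868; 56668884]; 5626]; 8562; 566888; 6586]; 56686684; 562662; P 0
  0 3 4]; 586888; P 0 4 4 2]; 5886; 5868]; 588686; P 0 4 6 2; S 5 2 [:: 658888; 6858488866;
  5868]]; 65866688; 5686]]]; S 8 4 [:: 45844442; 5448; 5484]]]]; 6586]; S 6 4 [:: P 0 4 6 4; S 4 5
  [:: 5686; S 4 4 [:: 6586; 6588; S 3 6 [:: S 2 6 [:: P 0 0 2 6; 566662; 566266; S 3 4 [:: S 3 5
  [:: 2586; 8526; 2584]; S 3 5 [:: 5626; 25666684]; P 0 0 3 4; S 3 5 [:: S 2 5 [:: 5686; S 2 4 [::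
  665886; S 3 7 [:: P 0 4 3 5; 526662; 526266; S 4 7 [:: 5424; S 5 7 [:: 4526; 4524; S 4 3 [::
  586888; 584488; P 0 4 4 3; S 5 3 [:: 5884; S 3 3 [:: S 2 3 [:: 5886; 86566688; 5868]; 8566;
  6586; 566868]; 5484]]; 2544]; 5224]]; 885668]; 5668]; 5626]]]; P 0 0 3 6; S 3 5 [:: 8566; 6586;
  8562; S 3 4 [:: S 6 3 [:: S 3 7 [:: S 2 6 [:: S 2 5 [:: 86566666; S 5 3 [:: 58884442; 5848; S 4
  3 [:: 5668; 56886684; 5686]]; 5868]; 5662; 56226662; 5626]; 5262; 52226662; 5226]; 5886; 5868; S
  3 7 [:: 52266262; 5262; 52262662; 5226]]; 58666684; P 0 0 3 4]]; S 3 5 [:: 5662; S 3 4 [:: S 4 7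
  [:: S 3 7 [:: P 0 4 3 5; 562662; 562266]; S 5 7 [:: 4526; 4524; 522424; S 6 7 [:: 5224; 5242;
  25422266]]; 5224; 5242]; 5868; 5886]; 5626]]; 8566]; S 6 3 [:: 588448; 5886; 5868; S 7 3 [::
  48588844; S 5 3 [:: 6588; 8566; S 4 4 [:: S 4 3 [:: 58668862; 5868; 5886]; P 0 4 4 4; 5626];
  6586]; 5484]]]]; P 0 4 7 4]]]; S 4 5 [:: 5668; 5686; S 6 4 [:: P 0 4 6 4; S 5 7 [:: P 0 4 5 5; S
  4 7 [:: 562622; S 7 5 [:: P 0 0 5 5; S 7 4 [:: 548848; 4584; 8544; S 7 6 [:: 5424; S 6 3 [::
  588848; 5886; S 8 5 [:: 544848; 5442; S 8 4 [:: 84544484; S 4 4 [:: S 8 6 [:: 2544; 4522; 4524;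
  S 4 3 [:: 58668862; S 7 7 [:: 52442242; S 6 7 [:: 6544; 4562; P 0 0 5 7]; 5226; 5262]; 5868;
  5886]]; 85666684; 5662]; 5848]; 5424]; 5868]; 5224]]; S 7 6 [:: 5424; 5442; S 3 6 [:: 566226;
  56266684; P 0 0 3 6; S 3 7 [:: 65266662; 5662; 5626]]]; S 7 6 [:: 5424; 5442; S 7 7 [:: S 6 7
  [:: 6524; 6526; S 8 7 [:: S 8 6 [:: P 0 0 6 6; 84544224; 58422442]; S 4 4 [:: 56886686;
  58688666; P 0 0 4 4]; 5424; 5442]]; S 6 7 [:: 6544; 4562; P 0 0 5 7]; S 7 8 [:: 522444;
  52242248; P 0 4 7 6; S 8 7 [:: 542444; 54242248; S 6 7 [:: P 0 0 6 7; S 8 6 [:: 8544; S 8 5 [::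
  854488; S 6 8 [:: 6522; 6524; 6526; 562226]; P 0 4 8 5]; 4584; 8542]]; S 6 7 [:: S 6 8 [:: 5226;
  S 5 8 [:: 522622; 6524; 6526; 2566]; 5626]; P 0 0 6 7]]]; P 0 4 7 5]]]; P 0 4 4 5]; S 6 7 [::
  5224; 5424; S 4 7 [:: 562226; S 3 6 [:: 566226; 5686; 5668; S 3 7 [:: 26566622; S 3 5 [:: 8566;
  S 4 4 [:: S 3 4 [:: 56886684; 5668; 5686]; 5848; P 0 0 4 4]; 6588; 6586]; 5262]]; 6526; 2566]];
  S 6 7 [:: 5224; 5242; S 3 6 [:: 566226; S 3 5 [:: P 0 0 3 5; 568686; S 4 7 [:: 225662; 5242; S 3
  7 [:: S 4 4 [:: S 3 4 [:: 5886; S 4 3 [:: 58488862; S 5 3 [:: 5484; S 3 3 [:: 6586; 8566; 6588;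
  S 6 3 [:: 885448; S 2 5 [:: 562666; 5686; S 2 4 [:: 8566; S 2 6 [:: 26566662; 5262; S 2 3 [::
  6586866624; P 0 0 2 3; 88856666]]; 6586; 8562]; 5668]; 885444]]; 48588886]; 5868; 5886]; 5686];
  S 3 4 [:: 665888; 885666; 5868]; P 0 0 4 4]; 5626; 5662]]]; P 0 0 3 6; S 3 5 [:: 8566; S 4 4 [::
  S 4 7 [:: 665222; 665224; S 3 4 [:: S 3 7 [:: S 2 6 [:: S 3 3 [:: 58668868; P 0 4 3 3; 58688842;
  S 4 3 [:: S 5 3 [:: P 0 4 5 3; 544886; P 0 0 3 3]; S 5 3 [:: 5484; S 2 5 [:: 86566226; 86566262;
  5868]; 5448]; 5868]]; 5626; 566866; 5662]; 5226; 5626]; 5668; 5686]]; 5848; P 0 0 4 4]; 568686;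
  6586]]]]; S 4 4 [:: S 5 3 [:: P 0 4 5 3; S 4 3 [:: S 6 3 [:: 584488; P 0 0 4 3; S 6 7 [:: 5224;
  5242; S 5 7 [:: P 0 4 5 5; 62522224; S 7 4 [:: 544488; S 7 3 [:: 85488884; S 7 5 [:: 2548; 4522;
  522444; 4524]; 5484]; 54488862; P 0 0 5 4]]; S 5 7 [:: P 0 4 5 5; S 4 7 [:: 522266; S 5 8 [::
  526222; P 0 4 5 6; 52222248; S 4 8 [:: S 6 8 [:: 2544; 4524; S 7 7 [:: 54242422; 5448; 5484;
  54244222]; 54422268]; 5626; 5226]]; P 0 0 4 7]; 56244222]]]; 5868; 5886]; S 4 3 [:: S 6 3 [::
  584488; P 0 0 4 3; S 5 7 [:: P 0 4 5 5; S 4 7 [:: 522266; S 7 6 [:: 5424; 5442; S 7 5 [:: P 0 0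
  5 5; 84544224; 58422442]; S 7 4 [:: 544488; S 7 3 [:: S 7 5 [:: 4522; 52244486; S 3 4 [:: S 3 5
  [:: 5262; S 3 6 [:: 562266; P 0 4 3 4; S 3 7 [:: 65266662; 5662; 5626]]; 26566668]; 56886662;
  5668; 5686]]; 5448; 5484]; S 7 5 [:: P 0 0 5 5; 852424]; P 0 0 5 4]]; P 0 4 4 5]; S 4 7 [::
  522266; S 6 7 [:: 5442; 5424; S 3 4 [:: S 3 6 [:: 562266; 5686; 5668; S 3 5 [:: 8562; S 3 7 [::
  26566622; 5226; 5262]; 6586]]; 56886684; 5668; 5686]]; 6526; 6522]; S 6 7 [:: 5224; 5242;
  45222442]]]; 5868; 5886]; S 6 3 [:: 548488; 4588; S 4 3 [:: S 7 4 [:: 544488; S 7 6 [:: 5424;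
  5442; 54224426; S 6 7 [:: 5224; 5242; 52224426; S 5 2 [:: 588488; S 6 2 [:: 48588884; S 4 2 [::
  6588; S 3 3 [:: 56886686; 5626; S 3 4 [:: S 3 5 [:: 5262; S 7 5 [:: 2548; 84544442; S 3 6 [::
  562266; P 0 4 3 4; S 3 2 [:: S 5 7 [:: 5626; 6522222448; S 4 7 [:: 522266; 52266684; 6526;
  6524]]; P 0 0 3 2; 66658888]]]; 5226]; 25688666; 5686]; 5662]; 8566; 6586]; 5484]; 5868;
  5886]]]; 5424; 5442]; 5668; 5686]; 4584]]; 885668; 665886]]]; S 4 5 [:: 5668; 5686; S 4 4 [::
  6586; S 4 3 [:: S 7 5 [:: P 0 0 5 5; S 5 7 [:: P 0 4 5 5; S 6 4 [:: 5484; S 7 4 [:: 548848;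
  4584; 8544; S 7 6 [:: 5424; S 6 3 [:: 588848; 5886; S 5 3 [:: 6584; 6586; S 6 2 [:: S 5 2 [::
  56888862; 68588884; P 0 4 5 2]; S 5 2 [:: 56844888; S 3 6 [:: 56222662; S 3 5 [:: 5662;
  85666684; S 3 4 [:: 58622662; 86566226; 5868]]; P 0 0 3 6; 56226262]; P 0 4 5 2]; 5884; 5848]];
  5868]; 5224]]; S 7 4 [:: 584848; S 6 3 [:: S 5 3 [:: 6548; P 0 0 4 3; 4568]; P 0 4 6 3; S 5 3
  [:: 5848; S 7 3 [:: 85488844; S 8 5 [:: 544848; P 0 0 6 5; S 8 4 [:: S 8 3 [:: S 6 2 [::
  58488842; 586886; S 7 2 [:: S 5 2 [:: 5668; S 8 2 [:: 58884444; 5848; 84544484]; 5686]; 4586;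
  4584; 588444]; P 0 4 6 2]; P 0 0 6 3; 548444]; 5484; 5448]; S 8 4 [:: 8454244486; 5484;
  854444]]; 5848]]; S 7 3 [:: 85488448; 5884; 5484]]; P 0 0 5 4]]; S 5 3 [:: 5848; 458888; S 6 7
  [:: 5224; 5242; S 6 4 [:: 5484; 4248588842; S 6 3 [:: 8544; 4588; S 4 7 [:: 225662; 665222; S 3
  5 [:: 5662; 5626; 568866; S 3 4 [:: 6258666884; S 3 3 [:: S 7 3 [:: 54488842; 54484486; S 7 4
  [:: S 7 6 [:: 5424; 445222; 445224]; 2584424426]; P 0 0 5 3]; 568866; P 0 0 3 3]; 5868]]];
  4584]]]]; S 6 7 [:: 5224; 5424; S 4 7 [:: S 7 6 [:: 5424; S 3 5 [:: 5662; 5626; S 3 6 [:: 5686;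
  52666684; S 3 7 [:: S 5 3 [:: 5848; S 3 4 [:: 66258886; P 0 0 3 4; S 6 3 [:: P 0 0 4 3;
  54886684; 54848488; 54844888]]; 85488884]; 5226; 5262]]; S 3 4 [:: S 3 3 [:: 6586; S 2 4 [::
  5662; 5626; 566866; 56868866]; 568866; 6588]; 58668862; 5868]]; 254484]; S 6 4 [:: 5484; S 7 6
  [:: 5424; S 5 3 [:: 5848; S 6 3 [:: 8544; 4588; 4584; S 7 4 [:: S 7 3 [:: 584848; P 0 0 5 3;
  588844]; 4584; 4588; 8542]]; S 6 3 [:: P 0 0 4 3; 5886; S 5 2 [:: S 6 2 [:: 45844888; 5884;
  5484]; S 6 2 [:: 45888862; 5884; 5848]; 58888862; P 0 4 5 2]]]; S 7 4 [:: 588444; 4584; 8544;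
  4588]]; 48588844]; 6526; 2566]]]; 544422; S 7 6 [:: 5424; 5442; S 3 5 [:: 5662; 5626; S 3 4 [::
  S 3 6 [:: P 0 4 3 4; 56266684; S 3 3 [:: 6586; 6588; 568866; S 5 3 [:: 5484; S 4 2 [:: 5884; S 3
  2 [:: 5686; S 5 2 [:: 4584; 8544; 4588; S 2 6 [:: S 6 3 [:: 5442; S 6 4 [:: 2588; 8524; 2586];
  54884484; 5424]; 56226624; 5626; 5662]]; 68588886]; 588866; 5848]; 5448]]]; P 0 0 3 4; S 3 6 [::
  225666; 665226; S 4 7 [:: S 3 7 [:: S 5 3 [:: 5848; S 6 3 [:: P 0 0 4 3; S 6 4 [:: 2588; 8524;
  2586]; 54848488; 54844888]; 85488884]; 5226; 5262]; 52266684; S 5 7 [:: 4526; S 3 7 [::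
  65266662; 5662; 5626]; 542422; 4524]; P 0 4 4 5]]]; S 3 6 [:: S 3 4 [:: 5886; S 3 3 [:: S 4 7
  [:: 5242; 52266684; S 3 7 [:: 62522226; S 5 7 [:: 4526; S 6 7 [:: 5242; 54422248; S 7 7 [:: S 5
  8 [:: 526226; P 0 4 5 6; 52422248; S 6 8 [:: 4526; 4524; 522444; S 4 8 [:: S 7 8 [:: 52224444;
  24544424; 5242]; 5626; 5662]]]; P 0 0 5 7; 542444]]; 2544; 4524]; 5626]; 5224]; 568866; P 0 4 3
  3]; 5868]; 56266684; 2566; 6526]]]]; S 5 3 [:: 5884; 5848; S 6 7 [:: 5224; 5242; S 5 7 [:: P 0 4
  5 5; 62522242; 62522224]; S 5 7 [:: P 0 4 5 5; 52422268; S 4 7 [:: 225662; 665222; S 3 5 [::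
  5662; 5626; 568866; S 3 7 [:: S 3 6 [:: S 6 4 [:: 5484; S 6 3 [:: 584888; P 0 4 6 3; S 7 5 [:: P
  0 0 5 5; S 7 4 [:: 544888; 4584; 8542; S 7 6 [:: 5424; S 7 3 [:: 48588848; 54448886; 5484];
  5224]]; 542442; 54484486]]; 45844488]; 2568; 6526]; 56222268; 5662; 5626]]]]]]; P 0 4 4 3; S 5 3
  [:: 5884; 5848; S 3 4 [:: S 3 3 [:: S 6 3 [:: S 3 5 [:: 5626; S 7 3 [:: 54484486; P 0 0 5 3;
  544888; S 6 2 [:: 58484486; S 6 4 [:: P 0 4 6 2; S 7 4 [:: 4524; 2548; S 7 5 [:: P 0 0 5 5;
  544424; P 0 4 7 3]; 2544]]; 584888; S 6 4 [:: S 7 4 [:: 5424; S 7 5 [:: 2548; 4524; 544424;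
  4522]; 5442]; P 0 4 6 2]]]; S 3 6 [:: 6522; S 4 2 [:: 584888; P 0 4 4 2; S 5 2 [:: 4586; S 3 2
  [:: 5886; S 6 2 [:: P 0 0 4 2; 584888; S 6 4 [:: S 7 4 [:: 5424; S 7 3 [:: 5848; 544888; S 7 5
  [:: 2548; 4524; 544424; 4522]]; 5442; 54442248]; P 0 4 6 2]]; 5686]; 4588; 4584]; 588848]; 2566;
  6526]]; S 6 4 [:: 2588; 8524; P 0 4 6 3]; S 6 4 [:: 2548; 4524; S 3 6 [:: S 3 5 [:: 8522; P 0 4
  3 4; 2586]; S 7 3 [:: 54884484; S 6 2 [:: 58884484; S 7 5 [:: P 0 0 5 5; S 7 4 [:: 258484;
  5242]; 544424; S 7 6 [:: 5424; 5442; 45244484]]; 5848; 5884]; 5448; 5484]; P 0 0 3 6; S 7 3 [::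
  54848484; 54844884; 5448; 5484]]]; P 0 0 4 3]; P 0 0 3 3; 586866]; S 3 5 [:: 5662; 5626; S 3 6
  [:: S 3 3 [:: 665888; S 2 5 [:: 5686; 562266; S 2 4 [:: S 2 3 [:: 5686; 65866868; 5668]; 8562; S
  2 3 [:: 8685666886; 5686; 5668]; 6586]; 5668]; 665886]; 522626; 6522; 6526]]; P 0 0 3 4; S 3 5
  [:: 5662; 5626; S 3 6 [:: 225666; 665226; S 3 3 [:: S 2 4 [:: 5626; 5662; S 2 3 [:: S 2 5 [:: S
  2 6 [:: 56226624; 5626; 5662]; 6522; 2568; 6526]; 86566688; 5868]; 568866]; 6586; 6588;
  588866]]]]]]; S 6 4 [:: 5484; 5448; S 6 7 [:: 5224; 5242; S 5 7 [:: P 0 4 5 5; S 7 5 [:: P 0 0 5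
  5; S 4 7 [:: 562626; S 7 4 [:: 584848; S 7 7 [:: S 7 6 [:: 8542; 4584; S 3 7 [:: S 3 6 [::
  86566262; P 0 0 3 6; 86566226]; 5662; S 3 6 [:: 566662; S 3 5 [:: 5662; 5626; S 3 4 [:: S 2 6
  [:: 56626624; 568666; S 2 7 [:: S 3 8 [:: 5242; 5224; S 4 8 [:: S 5 8 [:: P 0 0 3 8; S 6 8 [::
  2544; 4524; 544424; 54422268]; 2654422226]; 4526; 4524; 4522]; 526222]; 6526; 2566; 566222]; P 0
  0 2 6]; 5886; 5868]]; P 0 0 3 6]; 5626]]; P 0 0 5 7; S 7 6 [:: 8522; 2584; P 0 4 7 5]; S 7 6 [::
  5424; S 8 7 [:: S 3 7 [:: S 3 6 [:: 86566262; P 0 0 3 6; 86566668]; 5662; S 7 3 [:: S 6 3 [:: P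
  0 4 6 3; 68588844; 68588868]; 5884; S 6 3 [:: 5688848444; P 0 4 6 3; S 8 6 [:: 542224; S 8 5 [::
  4588; 8542; 4584; 8854484486]; 5484]]; 5848]; 5626]; 54222444; 54424426; P 0 0 6 7]]]; P 0 0 5
  4]; P 0 0 4 7]; S 7 6 [:: 5424; 5442; S 7 4 [:: 445884; S 5 3 [:: 5884; 586688; 5848; S 6 3 [::
  S 7 3 [:: 4485888448; 5884; 5848]; 4586; S 7 3 [:: 85488844; 5884; 5848]; 4584]]; 885444]]; S 7
  6 [:: 5424; 5442; S 7 4 [:: S 7 7 [:: 4524; 2544; S 8 5 [:: 5424; 5442; 54844426; S 8 6 [::
  2544; S 8 4 [:: 5884; S 8 7 [:: 44452224; P 0 0 6 7; S 9 4 [:: P 0 0 7 4; S 9 5 [:: 25444448; S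
  9 6 [:: S 10 5 [:: S 10 4 [:: 5848; 4584844442; 84544484]; 5424; 5442; 54488444]; 5242;
  52488444]; 5448]; 54884844; 54888444]]; 5848]; 2548; 4524]]; 4522]; 4584; 58844426; 4588]]]; S 4
  7 [:: S 5 8 [:: 5242; 52622248; 5224; S 4 8 [:: S 6 8 [:: 4522; 2544; S 7 6 [:: 5424; 5442; S 7
  7 [:: 4524; S 8 6 [:: 5448; 5484; S 7 8 [:: 22654442; P 0 0 5 8; S 8 7 [:: S 8 5 [:: P 0 4 8 5;
  S 7 5 [:: 6548; 4568; 6542]; 58484844; 58488444]; P 0 0 6 7; 52488444]]; S 8 7 [:: 24544448;
  52444426; P 0 0 6 7]]; 2548; 2544]; S 7 5 [:: P 0 0 5 5; 584448; 584844]]; 4524]; S 6 8 [::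
  4522; S 7 6 [:: 5424; 5442; S 7 7 [:: 4524; 2548; S 7 5 [:: 5848; 5884; S 7 4 [:: S 8 5 [::
  5424; 5442; 54844426; 54884484]; 4584; 54488862; 4588]]; 2544]; 544848]; 2544; 4524]; 5626]];
  56622248; 6526; 2566]]; S 5 7 [:: P 0 4 5 5; S 4 7 [:: 256622; S 3 6 [:: S 3 7 [:: 5662; S 3 5
  [:: 885666; 5626; S 3 4 [:: 5886; 6685888666; 5868]]; 5626]; S 3 5 [:: 5662; 5626; S 3 4 [:: S 3
  7 [:: 65266622; S 2 6 [:: 56626624; 566866; S 2 7 [:: S 2 5 [:: 5886; 5686; S 3 8 [:: 5242;
  5224; S 4 8 [:: S 5 8 [:: P 0 0 3 8; S 2 8 [:: 56662224; 5626; 62522262]; 2544222266]; 4526;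
  4524; 4522]; 526222]]; 6526; 2566; 566222]; P 0 0 2 6]; 5626]; 5886; 5868]]; P 0 0 3 6; S 3 7
  [:: 65266226; 5662; 5626]]; P 0 4 4 5]; 652422]]]; 6588]]]].

(** This starts from no labels at all; leaves [P 0] refer to [line] and [P 1] to [square]. The first
    two splits have a single branch each, as two adjacent cells bear labels 0 and 1 up to naming. *)
Definition cart_cert : cert :=
  S 5 5 [:: S 5 4 [:: S 5 6 [:: P 0 4 5 4; S 4 5 [:: S 4 4 [:: 6586; P 1 1 5 4; S 4 6 [:: 5262;
  5226; S 6 5 [:: P 0 0 4 5; S 6 6 [:: 4524; P 1 1 6 5; P 1 1 6 5; 2544]; S 6 6 [:: P 1 0 5 5; S 6
  4 [:: 5484; 445884; S 4 3 [:: 586868; P 0 4 4 3; S 5 3 [:: 5884; 5848; S 6 3 [:: P 1 0 5 3;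
  4584; 8544; 4588]]; 586688]]; P 0 0 4 6]; S 6 4 [:: 5484; S 6 6 [:: P 1 0 5 5; 225442; S 6 3 [::
  588484; S 5 3 [:: 6588; 6586; 6584; P 1 1 6 3]; 588844; P 0 4 6 3]]; 5448]]]]; S 4 4 [:: 5868; S
  4 6 [:: 6526; P 1 0 4 5; 6522; S 6 5 [:: S 6 4 [:: 4584; P 1 0 5 4; 8544; P 1 0 5 4]; P 0 0 4 5;
  S 6 6 [:: 5424; S 6 4 [:: P 1 1 6 4; 885448; S 4 3 [:: 586868; S 5 3 [:: 4588; P 1 0 4 3; 4584;
  4586]; P 0 4 4 3; 586688]]; 5442]; S 6 4 [:: P 1 1 6 4; S 6 6 [:: 5424; 445224; S 6 3 [::
  588448; S 5 3 [:: 6588; 6586; 6584; P 1 1 6 3]; 588844; P 0 4 6 3]]; P 0 0 4 4]]]]; S 4 4 [:: P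
  1 0 4 4; S 4 3 [:: S 4 6 [:: P 1 1 5 5; 562242; S 6 6 [:: S 6 5 [:: 8542; 4584; 8544; P 1 0 5
  5]; 542242; 542422; P 0 0 4 6]]; S 5 3 [:: 4588; 4584; P 1 0 4 3; S 6 5 [:: S 6 4 [:: 4584;
  8544; P 1 0 5 4; 8542]; S 6 6 [:: 4524; P 1 1 6 5; P 1 1 6 5; P 1 1 6 5]; P 0 0 4 5; S 6 4 [:: P
  1 1 6 4; 5442; S 6 3 [:: 458844; P 0 0 4 3; S 6 6 [:: P 1 0 5 5; S 5 2 [:: 588868; P 0 4 5 2; S
  6 2 [:: P 1 0 5 2; P 1 0 5 2; 4588; 4584]; 588688]; P 0 4 6 4]]]]]; P 0 4 4 3; S 5 3 [:: P 0 4 5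
  3; P 1 1 5 3; S 4 6 [:: P 1 1 5 5; 652262; 652226]]]; S 4 6 [:: P 1 1 5 5; S 5 3 [:: P 0 4 5 3;
  S 4 3 [:: 568884; P 1 0 4 3; P 0 4 4 3]; S 4 3 [:: 568848; P 1 0 4 3; S 6 3 [:: 548848; S 6 4
  [:: 2548; P 1 1 6 3; 4524; 2544]; P 0 0 4 3; 548488]]; S 4 3 [:: P 1 1 5 3; 6586; P 1 1 5 3;
  6588]]; P 0 4 4 4]]]]]].

(** * Certificates for the strong product *)

Definition dist20_cert : cert :=
  S 5 4 [:: S 5 3 [:: S 4 3 [:: S 5 5 [:: 3513; 3512; S 3 4 [:: 5666; 5639; 5693; S 3 3 [:: 5966;
  5939; 5993; S 3 5 [:: 5366; 5339; S 4 5 [:: 5239; S 2 4 [:: 5932; 965369; 965366; 365966; S 4 2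
  [:: 5887; 576974; S 3 2 [:: 5898; 586974; S 2 3 [:: 5698; 566974; 5396; 5369]; 5889; 594796];
  5878; 584796]]; S 2 4 [:: 5932; S 6 3 [:: 857471; 5871; 857444; 857417; S 4 6 [:: 5132; 5233;
  522368; 5123; 511369]]; S 6 3 [:: 854771; 5871; 854744; 854717; S 5 2 [:: 5787; 5977; 598742;
  5778; 584479]]; S 6 5 [:: 5217; 254171; 254144; 254117; S 4 6 [:: 5132; 5239; S 5 6 [:: 1532;
  3513; 3514; 3511; S 3 6 [:: 5232; 5339; 5366; 5223; 5393]]; 5123; 351136]]; S 3 6 [:: 5232; S 4
  6 [:: 5132; S 4 2 [:: 5887; S 5 2 [:: 5787; 458887; 5778; S 6 3 [:: 5712; 5871; S 2 5 [:: 5632;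
  653366; 259362; 653339]; 5777]; 458878]; 598874; 5878; 589748]; 5214; 251136]; S 4 6 [:: 5132; S
  5 6 [:: 541361; S 2 5 [:: 5632; 5966; 259368; S 2 6 [:: 5332; 5666; S 4 7 [:: 521361; 3512;
  3514; S 5 7 [:: 511361; 254122; 5132; 254113; 5217]; 3511; 3513]; 5232; 5223]]; 5141; 5114; S 6
  5 [:: 5217; 251479; 571127; 5178]]; 5214; 251136]; S 4 6 [:: 4533; 4532; S 2 5 [:: 5632; 256631;
  5963; S 2 6 [:: 5332; 65393216; 5663; 5232; 5223]]; 5214; 251136]; 5223; 352136]]]; 5393; S 4 5
  [:: 5239; S 5 2 [:: 5788; 5797; S 4 2 [:: 5888; 5897; 5879; S 3 2 [:: 5897; 5997; S 6 3 [::
  5441; S 6 2 [:: 547894; 547984; 5741; 88577422; 5714]; 854712; 5414]; S 2 3 [:: 5697; 539984; S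
  6 3 [:: 5171; 854741; 854714; 5144]; 5393; 5366]; 5888]]; 5779; S 6 3 [:: 5174; 5871; 517786; S
  4 2 [:: 6579; 5897; S 6 2 [:: 547876; S 5 1 [:: 587876; 5978; 5874; 587786; 5987]; 5474; 5447;
  547786]; 6578; 7569]]; S 4 2 [:: 5888; 5897; S 6 3 [:: S 3 2 [:: 5897; 5997; 5966; 5888; 5939];
  5871; S 2 4 [:: 9539; 566638; 566368; 3596; 9533; S 2 5 [:: 5631; 536638; 536368; 652363;
  652336]]; S 4 6 [:: 5222; 5231; 513368; 5213; 13533214]]; 5879]]; S 6 3 [:: S 3 2 [:: 5897;
  5993; 5966; S 4 2 [:: 5797; 5893; 5788; S 5 2 [:: 7598; 9579; 9571; 9577; 9574]]; 5888; S 4 2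
  [:: 5797; 5893; S 5 2 [:: 7598; 9579; 9577; 9574; 9571]; 5788]]; 5871; S 2 4 [:: 9539; 566638;
  566368; 9536; S 2 3 [:: 5697; 596638; 596368; S 3 2 [:: 7598; 7599; 7596; 9578; 9579; S 4 2 [::
  5797; S 5 2 [:: 459744; 957742; 5744; 5717]; 5779; 5871]]; 658966]; 3596]; S 2 4 [:: 9539;
  593638; 593368; 9536; S 2 3 [:: 5697; 569638; 569368; S 4 6 [:: 5131; 513638; 513368; 351126;
  5122]; 658966]; 3596]; S 4 6 [:: 5131; 5233; 522368; S 5 6 [:: 541324; 5133; 512368; 541234; S 6
  5 [:: 5217; 5741; 22571248; 5714]]; 5122]]]; S 4 5 [:: 5239; S 3 2 [:: 5988; 5997; S 5 2 [::
  5788; 5797; S 4 2 [:: 4599; 4598; 5879; S 6 3 [:: 5441; S 6 2 [:: 547894; 547984; 5741;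
  88577422; 5714]; 854712; 5414]]; 5779; S 6 3 [:: 5441; 5871; 85187422; S 4 6 [:: 5222; 5231;
  513368; 5213; 25132398]]; S 6 3 [:: 5441; 5871; 517786; 854712]]; S 4 2 [:: 5888; 5897; 5879; S
  5 2 [:: 5788; 5797; S 4 1 [:: 588876; 597984; 7598; 9579; 588786; 9578]; 5779; S 6 3 [:: 5174;
  5871; S 2 3 [:: 539894; 596638; 596368; 5663; 5636]; 5147]]]; 5979; S 4 2 [:: 5888; 5897; S 5 2
  [:: 5788; 5797; 5779; S 4 1 [:: 958799; 588984; S 6 3 [:: 5174; 5412; S 2 3 [:: 539876; 596638;
  596368; 5663; 5636]; 451178]; 5974; 957888]; S 4 1 [:: 588894; 588984; 7598; 9579; 597786;
  9578]]; 5879]]; S 2 4 [:: 5398; S 6 5 [:: 5217; S 4 2 [:: 5798; 5899; 588962; 5789; 577963];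
  251444; 251417; 251471]; S 6 3 [:: S 4 2 [:: 5798; 5893; S 5 2 [:: 7598; 9579; 9577; 9574; S 3 2
  [:: 5898; 5993; 5966; 5889; 5939]]; 5789; 957796]; 5871; 854744; 854717; 854771]; S 3 2 [::
  5898; S 4 2 [:: 5798; S 4 6 [:: 5221; S 6 3 [:: 5711; 5871; S 5 2 [:: 547994; S 6 5 [:: 5217;
  5113; 5131; 5178; 251479]; 5747; 957781]; 5778; 857479]; 532214; 523142; 5212]; 5874; 857796]; S
  4 2 [:: 4599; 4598; S 2 3 [:: 5698; 856697; 5369; S 2 2 [:: 5998; 65939876; 5889; 5669; 5898]];
  5874; 857796]; S 4 2 [:: 5798; S 5 2 [:: 547967; S 2 3 [:: 5698; 5366; 853962; S 2 2 [:: 5998;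
  5666; S 4 1 [:: 587967; 9574; 9579; S 5 1 [:: 577967; 5798; 5871; 854788; 854779]; 9578; 9577];
  5889; 5898]]; 5774; 5747; S 6 3 [:: 5712; 5871; 517781; 857413]]; 5874; 857796]; 5889; 958796];
  S 6 5 [:: 5217; S 5 6 [:: 5121; 5311; 532148; 5112; 524413]; 254144; 254117; 254171]]]]]]]]]].

(** This extends [dist21]; leaves [P 0] refer to [dist20]. *)
Definition dist21_cert : cert :=
  S 5 4 [:: S 5 5 [:: S 4 5 [:: S 5 6 [:: 5314; S 7 6 [:: 5114; 5141; S 6 6 [:: 5214; S 7 5 [::
  5414; 5441; 581712; S 6 7 [:: P 0 4 6 5; 531172; 531442; S 8 5 [:: P 0 0 6 5; 571172; 571442;
  457711; 5478; S 7 4 [:: 5714; 5741; 5887; S 6 4 [:: 5987; 5978; S 4 6 [:: 5633; S 6 3 [:: 5977;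
  5787; 5778; 598749; 5896]; P 0 0 4 6; 22563922; 22563931]]; 5878]]; S 7 7 [:: S 8 6 [:: 754117;
  754144; 754171; 5712; S 8 5 [:: 5874; 571172; 571442; 857711; S 7 4 [:: 5714; 5741; 5974; S 6 4
  [:: 5898; 5889; 658796]; 957886]]]; 521172; 521442; 521712; P 0 4 7 5]]]]; P 0 0 5 6; S 6 6 [::
  5214; S 7 5 [:: 5414; 5441; 5741; S 7 7 [:: S 7 4 [:: 5714; 5741; 5789; S 6 4 [:: 5889; 5898; S
  6 7 [:: 652217; 5214; 651362; 651326]]; 5798; S 6 4 [:: 5889; S 6 7 [:: 652217; 5214; 651361;
  651334]; 5898]]; 512172; 5114; 5141; P 0 4 7 5; S 6 7 [:: P 0 4 6 5; 522172; 5214; S 5 7 [:: S 4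
  6 [:: 935226; 225936; 225938; 225939]; 532172; 5314; 5632; P 0 0 5 7]]]]; S 7 5 [:: 5414; 5441;
  S 7 4 [:: 5714; 5741; 584712; P 0 4 7 4; S 8 5 [:: 5178; 544172; 154714; 154741; S 8 6 [:: S 6 4
  [:: 659741; 5896; S 5 3 [:: 5796; 5996; 578936; 759893; 5969]]; 514172; 514442; 514712; P 0 0 6
  6]]; S 6 4 [:: 594712; S 5 3 [:: 5796; 5998; 578936; 759886; S 4 3 [:: 5896; P 0 4 4 3; 588936;
  5696; S 3 4 [:: 5669; 5696; 568936; 563983; S 3 5 [:: 5369; 5396; 538936; 253398; 5236]]]]; P 0
  4 6 4]]; S 7 4 [:: 5714; 5741; 857712; P 0 4 7 4; 5874; S 6 4 [:: 958712; S 8 5 [:: 5447; S 8 4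
  [:: 5747; 87571488; 87571479; P 0 0 6 4; 5774]; 754178; S 8 6 [:: 5412; 45241479; 451178; 5174;
  S 5 3 [:: 5796; 596976; 5998; 759886; S 8 4 [:: 5747; 547127; S 7 3 [:: 5789; 587127; 5898;
  5889; 597718]; 5441; 5774]]]; 5474]; 5974]]; S 6 4 [:: S 5 3 [:: 5974; 985789; 785989; 785988;
  785986]; S 7 4 [:: 5714; 5478; 457712; P 0 4 7 4; S 5 7 [:: 5232; S 6 7 [:: 5223; 5123; 542136;
  5232]; 5223; S 6 7 [:: 5223; 451136; 5123; 5232]; S 4 6 [:: 5632; S 4 7 [:: 5332; 5232; 5223;
  5636; 536316]; 5936; 566316]; 5332]]; S 5 3 [:: 5796; S 6 3 [:: 5889; S 7 4 [:: 5714; 157442; S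
  7 3 [:: 5877; 5478; P 0 0 5 3; 457796; 5798]; 154796]; S 7 4 [:: 5714; 5741; 157712; S 8 5 [::
  5712; 745144; 745147; 745141; 745142]]; S 6 2 [:: 5778; 5787; 588796; S 5 2 [:: 5878; 5887;
  598796; S 7 4 [:: 5714; 5741; 5412; S 4 3 [:: 5896; 658893; 5398; 53998844]]; 598976]; P 0 4 6
  2; 588976]; 5898]; S 6 3 [:: 5889; 547983; 547893; 47588766; 5898]; 759886; 5998]; P 0 4 6
  4]]]]]]]].

(** This extends [dist22]; leaves [P 0] refer to [dist20] and [P 1] to [dist21]. *)
Definition dist22_cert : cert :=
  S 5 4 [:: S 5 5 [:: S 4 5 [:: S 6 5 [:: P 0 0 4 5; S 6 4 [:: P 0 0 4 4; P 1 1 6 4; S 5 6 [:: P 0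
  4 5 4; P 1 5 6 4; S 6 3 [:: P 1 1 6 3; P 1 5 6 3; S 5 3 [:: 5799; P 1 4 5 3; 657896; S 7 4 [:: P
  1 5 7 4; 5177; P 1 1 7 4; S 7 5 [:: P 1 0 5 4; 5711; P 1 4 6 3; S 3 4 [:: 5933; 5699; S 4 3 [::
  5899; P 0 0 4 3; 5699; S 7 6 [:: 542144; 5411; 522144; 5211; P 0 0 5 6]]; S 4 3 [:: 5899; P 0 0
  4 3; 756986; 756968]; S 4 3 [:: 5899; 5799; 79566976; 5699]; P 1 1 5 3]]; P 1 0 5 3]]; P 0 4 6
  3; S 5 3 [:: 5799; P 1 5 5 3; P 1 4 5 3; S 4 3 [:: 5899; P 0 4 4 3; S 7 4 [:: P 1 5 7 4; 5711; P
  1 1 7 4; S 7 5 [:: 5411; 5711; P 1 1 7 5; S 7 6 [:: 5111; 5411; P 0 4 7 4; 5211; P 0 0 5 6]]; P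
  1 0 5 3]; P 1 0 4 3; P 0 0 4 3]]; S 5 3 [:: 5799; P 1 5 5 3; P 1 4 5 3; S 7 5 [:: P 1 0 5 4;
  5711; 574123; P 1 1 7 5; P 1 4 6 3]]]]]]]]].

(** The splits run through the 3 x 3 square centered at (4, 4), and every old label is refuted by an
    excluded distance. At the last cell (5, 5) all 8 labels are in use, so there is no branch for a
    new one. *)
Definition strong_cert : cert :=
  S 4 4 [:: S 4 3 [:: S 3 3 [:: S 3 4 [:: S 5 3 [:: P 0 0 3 3; P 1 1 5 3; S 5 4 [:: P 1 0 3 3; P 0
  0 3 4; S 4 5 [:: P 0 4 4 3; P 1 4 3 3; P 1 5 5 3; S 3 5 [:: P 1 5 4 3; P 0 4 3 3; P 2 1 5 3; P 1
  1 5 4; S 5 5 [:: P 1 4 4 3; P 2 0 3 3; P 1 0 3 4; P 0 4 5 3; P 0 0 3 5]]]]]]]]].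

Local Close Scope cert_scope.

(** * The excluded patterns *)

Local Notation cart_unrealizable := (unrealizable (cart_adj P_adj P_adj) 5).
Local Notation strong_unrealizable := (unrealizable (strong_adj P_adj P_adj) 8).

Definition tee : nat * labelling :=
  (2, [:: ((5, 5)%Z, 0); ((6, 5)%Z, 1); ((7, 5)%Z, 0); ((6, 6)%Z, 0)]).

(** The two pairs of opposite neighbors bear different labels; if their colors agreed, [tee] would
    occur. *)
Definition cross : nat * labelling :=
  (3, [:: ((5, 5)%Z, 0); ((6, 5)%Z, 1); ((7, 5)%Z, 0); ((6, 6)%Z, 2); ((6, 4)%Z, 2)]).

Definition line : nat * labelling :=
  (2, [:: ((5, 5)%Z, 0); ((6, 5)%Z, 1); ((7, 5)%Z, 0)]).

(** The other two corners bear different labels: with equal colors there, the path around the square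
    would be repetitive. *)
Definition square : nat * labelling :=
  (3, [:: ((5, 5)%Z, 0); ((6, 5)%Z, 1); ((6, 6)%Z, 0); ((5, 6)%Z, 2)]).

(** Up to symmetry, (2, 0), (2, 1) and (2, 2) are the only differences between distinct nonadjacent
    cells of a 3 x 3 square. *)
Definition dist20 : nat * labelling := (1, [:: ((4, 4)%Z, 0); ((6, 4)%Z, 0)]).
Definition dist21 : nat * labelling := (1, [:: ((4, 4)%Z, 0); ((6, 5)%Z, 0)]).
Definition dist22 : nat * labelling := (1, [:: ((4, 4)%Z, 0); ((6, 6)%Z, 0)]).

(** * Successive exclusion of the patterns *)

Lemma tee_excluded : cart_unrealizable tee.
Proof.
(* Running the checker settles all cases; what remains is that the patterns in [pats] are excluded,
   and here there are none. *)
apply: (check_sound (pats := [::]) cart_place _ (c := tee_cert)); last by vm_compute.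
by [].
Qed.

Lemma cross_excluded : cart_unrealizable cross.
Proof.
apply: (check_sound (pats := [:: tee]) cart_place _ (c := cross_cert)); last by vm_compute.
by move=> q; rewrite inE => /eqP ->; apply: tee_excluded.
Qed.

Lemma line_excluded : cart_unrealizable line.
Proof.
(* The order of [pats] fixes the indices by which the certificate refers to the patterns. *)
apply: (check_sound (pats := [:: tee; cross]) cart_place _ (c := line_cert)); last by vm_compute.
by move=> q; rewrite !inE => /orP[]/eqP->; [apply: tee_excluded | apply: cross_excluded].
Qed.

Lemma square_excluded : cart_unrealizable square.
Proof.
apply: (check_sound (pats := [:: line]) cart_place _ (c := square_cert)); last by vm_compute.
by move=> q; rewrite inE => /eqP ->; apply: line_excluded.
Qed.

(** Every coloring realizes the empty labelling, so excluding it rules out all nonrepetitive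
    colorings with at most 5 colors. *)
Lemma cart_excluded : cart_unrealizable (0, [::]).
Proof.
apply: (check_sound (pats := [:: line; square]) cart_place _ (c := cart_cert)); last by vm_compute.
by move=> q; rewrite !inE => /orP[]/eqP->; [apply: line_excluded | apply: square_excluded].
Qed.

Lemma dist20_excluded : strong_unrealizable dist20.
Proof.
apply: (check_sound (pats := [::]) strong_place _ (c := dist20_cert)); last by vm_compute.
by [].
Qed.

Lemma dist21_excluded : strong_unrealizable dist21.
Proof.
apply: (check_sound (pats := [:: dist20]) strong_place _ (c := dist21_cert)); last by vm_compute.
by move=> q; rewrite inE => /eqP ->; apply: dist20_excluded.
Qed.

Lemma dist22_excluded : strong_unrealizable dist22.
Proof.
apply: (check_sound (pats := [:: dist20; dist21]) strong_place _ (c := dist22_cert)); last by vm_compute.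
by move=> q; rewrite !inE => /orP[]/eqP->; [apply: dist20_excluded | apply: dist21_excluded].
Qed.

Lemma strong_excluded : strong_unrealizable (0, [::]).
Proof.
apply: (check_sound (pats := [:: dist20; dist21; dist22]) strong_place _ (c := strong_cert)); last by vm_compute.
move=> q; rewrite !inE => /or3P[]/eqP->; [apply: dist20_excluded | apply: dist21_excluded |].
exact: dist22_excluded.
Qed.

(** * The lower bounds *)

Lemma thue_gt adj K : unrealizable adj K (0, [::]) -> thue_ge adj K.+1.
Proof.
move=> no_coloring k f nr_f; rewrite ltnNge; apply/negP=> k_le.
(* With no labels there are no colors to name, so the empty list of colors serves. *)
exact: (no_coloring k f [::]).
Qed.

Theorem theorem1p7 :
  thue_ge (cart_adj P_adj P_adj) 6 /\ thue_ge (strong_adj P_adj P_adj) 9.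
Proof. exact: (conj (thue_gt cart_excluded) (thue_gt strong_excluded)). Qed.
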